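(* There exists a (synchronous) $2$-dimensional nondeterministic cellular automaton $\mathcal{A} = (\mathbb{Z}^2, S, N, \delta)$ such that for every aTAM tile assembly system $\mathcal{T} = (T, \sigma, \tau)$ there exists a finite initial configuration $c_0$ of $\mathcal{A}$ such that the CA system $(\mathcal{A}, c_0)$ simulates $\mathcal{T}$.
   Context: aTAM: A tile type is a unit square that cannot be rotated, with a glue on each side $\vec u\in\{N,E,S,W\}$ consisting of a label (string) and a nonnegative integer strength. Two adjacent tiles bind with the strength of the glue on their shared sides if the labels and strengths on those sides match (otherwise strength $0$). For a finite set $T$ of tile types, an assembly is a partial function $\alpha:\mathbb{Z}^2\dashrightarrow T$ defined on at least one point; $\alpha\sqsubseteq\alpha'$ means $\alpha'$ extends $\alpha$. An assembly is $\tau$-stable if every cut of its binding graph (edges weighted by binding strengths) has total weight at least $\tau$. A tile assembly system (TAS) is $\mathcal{T}=(T,\sigma,\tau)$ with $\sigma$ a finite $\tau$-stable seed assembly and $\tau\in\mathbb{N}$ the temperature. An assembly sequence is a (possibly infinite) sequence $\alpha_0=\sigma,\alpha_1,\dots$ where each $\alpha_{i+1}$ is obtained from $\alpha_i$ by adding a single tile at an empty position so that the tile binds to $\alpha_i$ with total strength at least $\tau$; its result is the union (limit) of the sequence. $\mathcal{A}[\mathcal{T}]$ denotes the set of producible assemblies (results of assembly sequences). For producible $\alpha,\alpha'$, $\alpha\longrightarrow\alpha'$ means there is an assembly sequence starting from $\alpha$ (with single-tile $\tau$-stable additions) whose result is $\alpha'$. Cellular automata: A $2$-dimensional nondeterministic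 CA is $\mathcal{A}=(\mathbb{Z}^2,S,N,\delta)$ with $S$ a finite set of states, $N=\{v_1,\dots,v_k\}\subset\mathbb{Z}^2$ a finite neighborhood, and $\delta:S^{|N|}\to 2^S$ the local rule. $S$ contains a unique quiescent state $q$ with $\delta(q,\dots,q)=\{q\}$. A configuration is a map $c:\mathbb{Z}^2\to S$; it is finite if all but finitely many cells are quiescent. The global rule $G:C\to 2^C$ (all cells update synchronously) is given by $c'\in G(c)$ iff for every $p\in\mathbb{Z}^2$, $c'(p)\in\delta(c(p+v_1),\dots,c(p+v_k))$; $G^n$ is its $n$-fold iteration on sets of configurations. A CA system is a pair $(\mathcal{A},c_0)$ with $c_0$ a finite configuration; let $\tilde C=\bigcup_{n\ge0}G^n(c_0)$. Rescaling: For $k\in\mathbb{Z}^2$, the shift $\psi^k$ maps $c$ to $c'$ with $c'(i+k)=c(i)$. For $m=(m_1,m_2)$ positive integers, the packing map $o^m:S^{\mathbb{Z}^2}\to (S^{[0,m_1]\times[0,m_2]})^{\mathbb{Z}^2}$ is $o^m(c)(z)(p)=c(mz+p)$ (componentwise product). An $\langle m,n,k\rangle$-rescaling of $\mathcal{A}$ is the CA with state set $S^{[0,m_1]\times[0,m_2]}$ and global transition $o^m\circ\psi^k\circ G^n\circ o^{-m}$. CA simulating a TAS: A representation function $R$ is a partial function from (single-cell) states to tile types, and $R^*:\tilde C\to\mathcal{A}[\mathcal{T}]$ its canonical cellwise extension to configurations. $\mathcal{T}$ follows $(\mathcal{A},c_0)$ iff for all $c\in\tilde C$, $\alpha,\beta\in\mathcal{A}[\mathcal{T}]$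 and $n\ge 0$: if $R^*(c)=\alpha$ and $\beta\in R^*[G^n(c)]$ then $\alpha\longrightarrow\beta$. $(\mathcal{A},c_0)$ models $\mathcal{T}$ iff for every $\alpha\in\mathcal{A}[\mathcal{T}]$ there is $c\in\tilde C$ with $R^*(c)=\alpha$ such that for every $\beta\in\mathcal{A}[\mathcal{T}]$ with $\alpha\longrightarrow\beta$ there is $n\ge0$ with $\beta\in R^*[G^n(c)]$. $(\mathcal{A},c_0)$ simulates $\mathcal{T}$ iff there is an $\langle m,n,k\rangle$-rescaling $\mathcal{A}'$ of $\mathcal{A}$ (with a representation function $R$ on its states) such that $\mathcal{T}$ follows $\mathcal{A}'$ and $\mathcal{A}'$ models $\mathcal{T}$ (the rescaled system starting from the packed initial configuration).
   Formalization: Producible assemblies and α⟶β use finite assembly sequences only (with infinite ones, e.g. an infinite line, the claim fails, as finite configurations represent only finite assemblies); rescaling blocks are half-open, [0,m1)×[0,m2), so that the packing map is invertible. *)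

(* Defs.v *)
From Stdlib Require Import ZArith String List.
From mathcomp Require Import all_boot.

Set Implicit Arguments.
Unset Strict Implicit.
Unset Printing Implicit Defensive.

Definition pos := (Z * Z)%type.
Definition addp (p q : pos) : pos := ((p.1 + q.1)%Z, (p.2 + q.2)%Z).
Definition subp (p q : pos) : pos := ((p.1 - q.1)%Z, (p.2 - q.2)%Z).
Definition pos_eqb (p q : pos) : bool := (Z.eqb p.1 q.1 && Z.eqb p.2 q.2)%bool.

Record glue := Glue { glabel : string; gstr : nat }.
Record tile := Tile { gN : glue; gE : glue; gS : glue; gW : glue }.

Inductive dir := DN | DE | DS | DW.
Definition dirs : list dir := DN :: DE :: DS :: DW :: nil.
Definition dvec (d : dir) : pos :=
  match d with DN => (0%Z, 1%Z) | DE => (1%Z, 0%Z) | DS => (0%Z, (-1)%Z) | DW => ((-1)%Z, 0%Z) end.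
Definition opp_dir (d : dir) : dir :=
  match d with DN => DS | DE => DW | DS => DN | DW => DE end.
Definition side (t : tile) (d : dir) : glue :=
  match d with DN => gN t | DE => gE t | DS => gS t | DW => gW t end.

Definition glue_match (g1 g2 : glue) : nat :=
  if (String.eqb (glabel g1) (glabel g2) && Nat.eqb (gstr g1) (gstr g2))%bool
  then gstr g1 else 0.

Definition bind_str (t : tile) (d : dir) (t' : tile) : nat :=
  glue_match (side t d) (side t' (opp_dir d)).

Definition assembly := pos -> option tile.

Definition upd (a : assembly) (p : pos) (t : tile) : assembly :=
  fun q => if pos_eqb q p then Some t else a q.

Definition str_at (a : assembly) (p : pos) (t : tile) : nat :=
  sumn (map (fun d => match a (addp p (dvec d)) with
                      | Some t' => bind_str t d t'
                      | None => 0 end) dirs).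

(* weight of the cut (A, complement of A) of the binding graph of a, whose
   domain is enumerated by D *)
Definition cut_weight (a : assembly) (D : list pos) (A : pos -> bool) : nat :=
  sumn (map (fun p =>
    match a p with
    | Some t =>
        if A p then
          sumn (map (fun d => let q := addp p (dvec d) in
                      match a q with
                      | Some t' => if A q then 0 else bind_str t d t'
                      | None => 0 end) dirs)
        else 0
    | None => 0 end) D).

Definition finite_asm (a : assembly) : Prop :=
  exists D : list pos, forall p, a p <> None -> In p D.

Definition stable (a : assembly) (tau : nat) : Prop :=
  forall D : list pos, List.NoDup D -> (forall p, In p D <-> a p <> None) ->
  forall A : pos -> bool,
    (exists p, In p D /\ A p = true) -> (exists p, In p D /\ A p = false) ->
    tau <= cut_weight a D A.

Definition is_TAS (T : list tile) (sigma : assembly) (tau : nat) : Prop :=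
  (forall p t, sigma p = Some t -> In t T) /\
  (exists p, sigma p <> None) /\
  finite_asm sigma /\ stable sigma tau.

Definition attach (T : list tile) (tau : nat) (a b : assembly) : Prop :=
  exists p t, In t T /\ a p = None /\ tau <= str_at a p t /\ b = upd a p t.

Definition asm_reach (T : list tile) (tau : nat) : assembly -> assembly -> Prop :=
  Relation_Operators.clos_refl_trans assembly (attach T tau).

Definition producible (T : list tile) (sigma : assembly) (tau : nat) (a : assembly) : Prop :=
  asm_reach T tau sigma a.

Fixpoint iter_rel (X : Type) (G : X -> X -> Prop) (n : nat) (x y : X) : Prop :=
  match n with
  | 0 => y = x
  | n'.+1 => exists z, iter_rel G n' x z /\ G z y
  end.

Definition Ctilde (X : Type) (G : X -> X -> Prop) (x0 x : X) : Prop :=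
  exists n, iter_rel G n x0 x.

Definition config (S : Type) := pos -> S.

Definition finite_config (S : Type) (q : S) (c : config S) : Prop :=
  exists D : list pos, forall p, c p <> q -> In p D.

Definition glob (S : finType) (k : nat) (N : k.-tuple pos)
  (delta : k.-tuple S -> {set S}) (c c' : config S) : Prop :=
  forall p, c' p \in delta (map_tuple (fun v => c (addp p v)) N).

Definition block (S : Type) (m1 m2 : nat) := 'I_m1 -> 'I_m2 -> S.

Definition packc (S : Type) (m1 m2 : nat) (c : config S) : config (block S m1 m2) :=
  fun z i j => c ((Z.of_nat m1 * z.1 + Z.of_nat i)%Z, (Z.of_nat m2 * z.2 + Z.of_nat j)%Z).

Definition shiftc (S : Type) (k : pos) (c : config S) : config S :=
  fun p => c (subp p k).

Definition glob_resc (S : finType) (kN : nat) (N : kN.-tuple pos)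
  (delta : kN.-tuple S -> {set S}) (m1 m2 n : nat) (k : pos)
  (C C' : config (block S m1 m2)) : Prop :=
  exists c c'', C = @packc S m1 m2 c /\ iter_rel (glob N delta) n c c'' /\
                C' = @packc S m1 m2 (shiftc k c'').

Definition Rstar (X : Type) (R : X -> option tile) (C : config X) : assembly :=
  fun z => R (C z).

Definition follows (X : Type) (G : X -> X -> Prop) (x0 : X) (Rs : X -> assembly)
  (T : list tile) (sigma : assembly) (tau : nat) : Prop :=
  forall c alpha beta n,
    Ctilde G x0 c -> producible T sigma tau alpha -> producible T sigma tau beta ->
    Rs c = alpha -> (exists c', iter_rel G n c c' /\ Rs c' = beta) ->
    asm_reach T tau alpha beta.

Definition models (X : Type) (G : X -> X -> Prop) (x0 : X) (Rs : X -> assembly)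
  (T : list tile) (sigma : assembly) (tau : nat) : Prop :=
  forall alpha, producible T sigma tau alpha ->
  exists c, Ctilde G x0 c /\ Rs c = alpha /\
    forall beta, producible T sigma tau beta -> asm_reach T tau alpha beta ->
    exists n c', iter_rel G n c c' /\ Rs c' = beta.

Definition simulates (S : finType) (kN : nat) (N : kN.-tuple pos)
  (delta : kN.-tuple S -> {set S}) (c0 : config S)
  (T : list tile) (sigma : assembly) (tau : nat) : Prop :=
  exists (m1 m2 n : nat) (k : pos) (R : block S m1 m2 -> option tile),
    0 < m1 /\ 0 < m2 /\
    (* R* : C~ -> A[T] is well defined *)
    (forall C, Ctilde (@glob_resc S kN N delta m1 m2 n k) (@packc S m1 m2 c0) C ->
               producible T sigma tau (Rstar R C)) /\
    follows (@glob_resc S kN N delta m1 m2 n k) (@packc S m1 m2 c0) (Rstar R) T sigma tau /\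
    models (@glob_resc S kN N delta m1 m2 n k) (@packc S m1 m2 c0) (Rstar R) T sigma tau.

(* Main.v *)
Require Import Defs.
From Stdlib Require Import ZArith String List.
From mathcomp Require Import all_boot.
From HB Require Import structures.
From mathcomp Require Import boolp zify.
From Stdlib Require Import Lia.

Set Implicit Arguments.
Unset Strict Implicit.
Unset Printing Implicit Defensive.

(** The automaton is an asynchronous deduction system: a cell is a finite set of
    facts, and at each step it may add one fact that a fixed rule derives from its
    neighbourhood. Facts are never retracted, so checks need no synchronisation and
    simultaneous additions can be serialised.

    A tile system is encoded by M "entries", an entry being a tile together with four
    claimed binding strengths (at most tau, hence finitely many). Each block is
    m x m with m = M^2, entry i owning column i and row M i of the block. A binary relation on entries is a function of i - M j mod m, so it can be written
    as a periodic one-dimensional word read along the diagonals x - y. Words that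
    are constant along rows, columns or diagonals spread from a finite seed to the
    whole plane by copying, the diagonals x = y (mod m) turning row information into
    column information and conversely.

    An empty block chooses an entry by scanning its bottom row from left to right;
    the entry is attached once each of the four claimed strengths is zero or matched
    by the entry attached in that neighbouring block. A bad choice only blocks its
    own block forever, and bad choices can be avoided, so every production of the
    tile system is still followed. One step of the automaton is one step of the
    rescaled automaton. *)

(** * Finite types of facts *)

Definition dir_code (d : dir) : bool * bool :=
  match d with DN => (true, true) | DE => (true, false)
             | DS => (false, true) | DW => (false, false) end.
Definition dir_decode (c : bool * bool) : dir :=
  match c with (true, true) => DN | (true, false) => DE
             | (false, true) => DS | (false, false) => DW end.
Lemma dir_codeK : cancel dir_code dir_decode. Proof. by case. Qed.
HB.instance Definition _ := Finite.copy dir (can_type dir_codeK).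

(* [Static l k] says that the periodic word [k] holds at the coordinate constant along
   [l]; [Scan false] passes over an entry and [Scan true] chooses it; [Dyn Col a]
   and [Dyn Row a] say that the claim [a] holds of the entry owning this column or row. *)
Inductive line := Row | Col | Diag.
Inductive attr := Zero | NonZero | ColPort | RowPort | Same | Free of dir | Compat of dir.
Inductive claim := Selected | Attached | Met of dir | Beside of dir.
Inductive fact := Static of line & attr | Scan of bool | Dyn of line & claim.

Definition line_code (l : line) : option bool :=
  match l with Row => None | Col => Some true | Diag => Some false end.
Definition line_decode (c : option bool) : line :=
  match c with None => Row | Some true => Col | Some false => Diag end.
Lemma line_codeK : cancel line_code line_decode. Proof. by case. Qed.
HB.instance Definition _ := Finite.copy line (can_type line_codeK).

Definition attr_code (k : attr) : bool * bool + option (bool * dir) :=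
  match k with
  | Zero => inl (true, true) | NonZero => inl (true, false)
  | ColPort => inl (false, true) | RowPort => inl (false, false)
  | Same => inr None | Free d => inr (Some (true, d)) | Compat d => inr (Some (false, d))
  end.
Definition attr_decode (c : bool * bool + option (bool * dir)) : attr :=
  match c with
  | inl (true, true) => Zero | inl (true, false) => NonZero
  | inl (false, true) => ColPort | inl (false, false) => RowPort
  | inr None => Same | inr (Some (true, d)) => Free d | inr (Some (false, d)) => Compat d
  end.
Lemma attr_codeK : cancel attr_code attr_decode. Proof. by case. Qed.
HB.instance Definition _ := Finite.copy attr (can_type attr_codeK).

Definition claim_code (a : claim) : bool + bool * dir :=
  match a with
  | Selected => inl true | Attached => inl false
  | Met d => inr (true, d) | Beside d => inr (false, d)
  end.
Definition claim_decode (c : bool + bool * dir) : claim :=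
  match c with
  | inl true => Selected | inl false => Attached
  | inr (true, d) => Met d | inr (false, d) => Beside d
  end.
Lemma claim_codeK : cancel claim_code claim_decode. Proof. by case. Qed.
HB.instance Definition _ := Finite.copy claim (can_type claim_codeK).

Definition fact_code (f : fact) : line * attr + bool + line * claim :=
  match f with
  | Static l k => inl (inl (l, k)) | Scan b => inl (inr b) | Dyn l a => inr (l, a)
  end.
Definition fact_decode (c : line * attr + bool + line * claim) : fact :=
  match c with
  | inl (inl (l, k)) => Static l k | inl (inr b) => Scan b | inr (l, a) => Dyn l a
  end.
Lemma fact_codeK : cancel fact_code fact_decode. Proof. by case. Qed.
HB.instance Definition _ := Finite.copy fact (can_type fact_codeK).

Definition cell : finType := {set fact}.

(** * Derivation rules and the local rule *)

(** At the cell where the column of entry i meets the row of entry j, the diagonal word decides a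
    relation between i and j. *)
Definition crossing (self : cell) (k : attr) : Prop :=
  [/\ Static Col ColPort \in self, Static Row RowPort \in self & Static Diag k \in self].

(** Static words are copied without bound, whereas the moves of [Dyn] facts are guarded by [NonZero]
    and stay inside a block; only the [beside] rules carry news of attachments over a block
    boundary. The absence of the opposite [Scan] fact is the only negative premise, and it concerns
    the cell itself. *)
Inductive rule (self n e s w ne sw : cell) : fact -> Prop :=
| row_from_east k : Static Row k \in e -> rule self n e s w ne sw (Static Row k)
| row_from_west k : Static Row k \in w -> rule self n e s w ne sw (Static Row k)
| col_from_north k : Static Col k \in n -> rule self n e s w ne sw (Static Col k)
| col_from_south k : Static Col k \in s -> rule self n e s w ne sw (Static Col k)
| diag_from_ne k : Static Diag k \in ne -> rule self n e s w ne sw (Static Diag k)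
| diag_from_sw k : Static Diag k \in sw -> rule self n e s w ne sw (Static Diag k)
| row_from_col k : Static Col k \in self -> Static Diag Zero \in self ->
    rule self n e s w ne sw (Static Row k)
| col_from_row k : Static Row k \in self -> Static Diag Zero \in self ->
    rule self n e s w ne sw (Static Col k)
| diag_from_col k : Static Col k \in self -> Static Row Zero \in self ->
    rule self n e s w ne sw (Static Diag k)
| choice_first b : Scan (~~ b) \notin self -> Static Row Zero \in self ->
    Static Col Zero \in self -> rule self n e s w ne sw (Scan b)
| choice_next b : Scan (~~ b) \notin self -> Static Row Zero \in self ->
    Static Col NonZero \in self -> Scan false \in w -> rule self n e s w ne sw (Scan b)
| move_up a : Dyn Col a \in s -> Static Row NonZero \in self ->
    rule self n e s w ne sw (Dyn Col a)
| move_down a : Dyn Col a \in n -> Static Row NonZero \in n ->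
    rule self n e s w ne sw (Dyn Col a)
| move_right a : Dyn Row a \in w -> Static Col NonZero \in self ->
    rule self n e s w ne sw (Dyn Row a)
| move_left a : Dyn Row a \in e -> Static Col NonZero \in e ->
    rule self n e s w ne sw (Dyn Row a)
| turn a : Dyn Col a \in self -> crossing self Same -> rule self n e s w ne sw (Dyn Row a)
| select : Scan true \in self -> Static Col ColPort \in self ->
    rule self n e s w ne sw (Dyn Col Selected)
| met_free d : Dyn Col Selected \in self -> crossing self (Free d) ->
    rule self n e s w ne sw (Dyn Col (Met d))
| met_compat d : Dyn Col Selected \in self -> Dyn Row (Beside d) \in self ->
    crossing self (Compat d) -> rule self n e s w ne sw (Dyn Col (Met d))
| attach_tile : (forall d, Dyn Col (Met d) \in self) -> crossing self Same ->
    rule self n e s w ne sw (Dyn Col Attached)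
| beside_north : Dyn Col Attached \in n -> Static Row Zero \in n ->
    rule self n e s w ne sw (Dyn Col (Beside DN))
| beside_south : Dyn Col Attached \in s -> Static Row Zero \in self ->
    rule self n e s w ne sw (Dyn Col (Beside DS))
| beside_east : Dyn Row Attached \in e -> Static Col Zero \in e ->
    rule self n e s w ne sw (Dyn Row (Beside DE))
| beside_west : Dyn Row Attached \in w -> Static Col Zero \in self ->
    rule self n e s w ne sw (Dyn Row (Beside DW)).

Definition nbhd : 7.-tuple pos :=
  [tuple (0, 0); (0, 1); (1, 0); (0, -1); (-1, 0); (1, 1); (-1, -1)]%Z.

(** A cell may always stay as it is, so asynchronous runs are among the runs of the synchronous
    automaton. *)
Definition local_rule (t : 7.-tuple cell) : {set cell} :=
  let at_ k := nth set0 t k in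
  [set s' | `[< s' = at_ 0 \/
     exists2 f, rule (at_ 0) (at_ 1) (at_ 2) (at_ 3) (at_ 4) (at_ 5) (at_ 6) f
              & s' = f |: at_ 0 >]].

(** Every rule has a positive premise, a fact in the cell or in a neighbour. *)
Lemma rule_quiescent f : ~ rule set0 set0 set0 set0 set0 set0 set0 f.
Proof.
move=> H; inversion H;
  try match goal with h : crossing _ _ |- _ => case: h => *; clear H end;
  match goal with
  | h : is_true (_ \in _) |- _ => by rewrite inE in h
  | h : forall d, is_true (_ \in _) |- _ => by move: (h DN); rewrite inE
  end.
Qed.

Lemma local_rule_quiescent : local_rule [tuple of nseq 7 set0] = [set set0].
Proof.
apply/setP => s; rewrite !inE; apply/asboolP/eqP => /= [[//|[f /rule_quiescent //]]|]; by left.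
Qed.

Notation step := (glob nbhd local_rule).

Definition derivable (c : config cell) (x y : Z) (f : fact) : Prop :=
  rule (c (x, y)) (c (x, y + 1)%Z) (c (x + 1, y)%Z) (c (x, y - 1)%Z) (c (x - 1, y)%Z)
       (c (x + 1, y + 1)%Z) (c (x - 1, y - 1)%Z) f.

Lemma stepP (c c' : config cell) :
  step c c' <-> forall x y, c' (x, y) = c (x, y) \/
                  exists2 f, derivable c x y f & c' (x, y) = f |: c (x, y).
Proof.
have E x y : (addp (x, y) (0, 0) = (x, y))%Z by rewrite /addp /= !Z.add_0_r.
have E1 x y : (addp (x, y) (0, 1) = (x, y + 1))%Z by rewrite /addp /= !Z.add_0_r.
have E2 x y : (addp (x, y) (1, 0) = (x + 1, y))%Z by rewrite /addp /= !Z.add_0_r.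
have E3 x y : (addp (x, y) (0, -1) = (x, y - 1))%Z by rewrite /addp /= !Z.add_0_r.
have E4 x y : (addp (x, y) (-1, 0) = (x - 1, y))%Z by rewrite /addp /= !Z.add_0_r.
by split=> H; [move=> x y; move: (H (x, y))| case=> x y; move: (H x y)];
  rewrite inE /= E E1 E2 E3 E4 => H'; [move/asboolP: H'|apply/asboolP].
Qed.

(** * Runs of the automaton and single additions *)

Definition reach (c c' : config cell) : Prop := exists n, iter_rel step n c c'.

Lemma iter_rel_trans (X : Type) (G : X -> X -> Prop) n k x y z :
  iter_rel G n x y -> iter_rel G k y z -> iter_rel G (k + n) x z.
Proof.
move=> xy; elim: k z => [z -> //|k IH z [u [yu uz]]].
by exists u; split=> //; apply: IH.
Qed.

Lemma reach_refl c : reach c c. Proof. by exists 0. Qed.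

Lemma reach_trans c1 c2 c3 : reach c1 c2 -> reach c2 c3 -> reach c1 c3.
Proof. by move=> [n H1] [k H2]; exists (k + n); apply: iter_rel_trans H1 H2. Qed.

Definition add_fact (c : config cell) (x y : Z) (f : fact) : config cell :=
  fun p => if pos_eqb p (x, y) then f |: c p else c p.

Lemma pos_eqbP (p q : pos) : reflect (p = q) (pos_eqb p q).
Proof.
case: p q => [x y] [x' y']; rewrite /pos_eqb /=.
apply: (iffP andP) => [[/Z.eqb_spec -> /Z.eqb_spec ->] //|[-> ->]].
by rewrite !Z.eqb_refl.
Qed.

Lemma in_add_fact c x y f p g :
  g \in add_fact c x y f p <-> g \in c p \/ (g = f /\ p = (x, y)).
Proof.
rewrite /add_fact; case: pos_eqbP => [->|ne]; last by split; [left|case=> // -[]].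
rewrite in_setU1; split=> [/orP [/eqP ->|]|[->|[-> _]]]; by [right|left|rewrite ?eqxx ?orbT].
Qed.

Lemma reach_add c x y f : derivable c x y f -> reach c (add_fact c x y f).
Proof.
move=> H; exists 1, c; split=> //; apply/stepP => x' y'.
rewrite /add_fact; case: pos_eqbP => [[-> ->]|_]; last by left.
by right; exists f.
Qed.

(** * Periodic words, block coordinates and the invariant *)

Section Blocks.
Local Open Scope Z_scope.

Variables (M m : Z) (free : dir -> Z -> Prop) (compat : dir -> Z -> Z -> Prop).
Hypotheses (M_gt0 : 0 < M) (mE : m = M * M).

(* The entry pair (i, j) meets at column i and row M j, whence the value i - M j. *)
Definition table (k : attr) (z : Z) : Prop :=
  match k with
  | Zero => exists b, z = m * b
  | NonZero => exists b r, 0 < r < m /\ z = m * b + r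
  | ColPort => exists b i, 0 <= i < M /\ z = m * b + i
  | RowPort => exists b j, 0 <= j < M /\ z = m * b + M * j
  | Same => exists b i, 0 <= i < M /\ z = m * b + i - M * i
  | Free d => exists b i, [/\ 0 <= i < M, z = m * b + i - M * i & free d i]
  | Compat d => exists b i j,
      [/\ 0 <= i < M, 0 <= j < M, z = m * b + i - M * j & compat d i j]
  end.

Definition coord (l : line) (x y : Z) : Z :=
  match l with Row => y | Col => x | Diag => x - y end.

(** The crossing of the entry's own column and row; under the invariant, [attach_tile] applies only
    at such cells. *)
Definition home (b : pos) (i : Z) : pos := (m * b.1 + i, m * b.2 + M * i).

Definition chosen (c : config cell) (b : pos) (i : Z) : Prop :=
  Scan true \in c (m * b.1 + i, m * b.2).

Definition attached (c : config cell) (b : pos) (i : Z) : Prop :=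
  Dyn Col Attached \in c (home b i).

Definition satisfied (c : config cell) (b : pos) (i : Z) (d : dir) : Prop :=
  free d i \/ exists j, [/\ 0 <= j < M, compat d i j & attached c (addp b (dvec d)) j].

(** The meaning of a claim refers only to scans on bottom rows and to attachments at home cells.
    [Attached] includes the choice, so that uniqueness of choices passes to attachments. *)
Definition holds (c : config cell) (b : pos) (a : claim) (i : Z) : Prop :=
  match a with
  | Selected => chosen c b i
  | Attached => attached c b i /\ chosen c b i
  | Met d => chosen c b i /\ satisfied c b i d
  | Beside d => attached c (addp b (dvec d)) i
  end.

(** The condition on [Scan] records that the scan has passed over every entry to the left;
    uniqueness of the choice rests on it. *)
Definition valid (c : config cell) (x y : Z) (f : fact) : Prop :=
  match f with
  | Static l k => table k (coord l x y)
  | Scan _ => exists b i, [/\ 0 <= i < m, x = m * b.1 + i, y = m * b.2 &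
      forall i', 0 <= i' < i -> Scan false \in c (m * b.1 + i', m * b.2)]
  | Dyn Col a => exists b i r,
      [/\ 0 <= i < M, 0 <= r < m, x = m * b.1 + i, y = m * b.2 + r & holds c b a i]
  | Dyn Row a => exists b i r,
      [/\ 0 <= i < M, 0 <= r < m, x = m * b.1 + r, y = m * b.2 + M * i & holds c b a i]
  | Dyn Diag _ => False
  end.

Record invariant (c : config cell) : Prop := Invariant {
  inv_valid : forall x y f, f \in c (x, y) -> valid c x y f;
  inv_choice : forall p, Scan true \in c p -> Scan false \notin c p;
  inv_finite : finite_config set0 c }.

Lemma pos_ext (p q : pos) : p.1 = q.1 -> p.2 = q.2 -> p = q.
Proof. by case: p q => [? ?] [? ?] /= -> ->. Qed.

Lemma m_gt0 : 0 < m. Proof. nia. Qed.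
Lemma le_Mm : M <= m. Proof. nia. Qed.
Lemma row_bound i : 0 <= i < M -> 0 <= M * i < m. Proof. nia. Qed.

Lemma block_inj b b' r r' : 0 <= r < m -> 0 <= r' < m ->
  m * b + r = m * b' + r' -> b = b' /\ r = r'.
Proof. by move=> hr hr'; apply: Z.div_mod_unique; left. Qed.

Lemma block_injM b b' r r' : 0 <= r < M -> 0 <= r' < M ->
  m * b + r = m * b' + r' -> b = b' /\ r = r'.
Proof. have := le_Mm => ? ? ?; apply: block_inj; lia. Qed.

Lemma block_injMM b b' r r' : 0 <= r < M -> 0 <= r' < M ->
  m * b + M * r = m * b' + M * r' -> b = b' /\ r = r'.
Proof.
by move=> hr hr' /block_inj [||-> ?]; [exact: row_bound|exact: row_bound|split=> //; nia].
Qed.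

(** The residue of i - M j modulo M is i, and the remaining quotient modulo M gives j. This is why
    blocks have side M^2. *)
Lemma crossing_inj b b' i j i' j' : 0 <= i < M -> 0 <= j < M -> 0 <= i' < M -> 0 <= j' < M ->
  m * b + i - M * j = m * b' + i' - M * j' -> i = i' /\ j = j'.
Proof.
move=> hi hj hi' hj' E.
have [E1 Ei]: M * b - j = M * b' - j' /\ i = i'.
  apply: (Z.div_mod_unique M); [by left|by left|rewrite mE in E; nia].
have [_ Ej]: - b = - b' /\ j = j' by apply: (Z.div_mod_unique M); [left|left|nia].
by [].
Qed.

Lemma table_shift k z b : table k z -> table k (z + m * b).
Proof.
case: k => /=.
- by move=> [b' ->]; exists (b' + b); lia.
- by move=> [b' [r [hr ->]]]; exists (b' + b), r; lia.
- by move=> [b' [r [hr ->]]]; exists (b' + b), r; lia.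
- by move=> [b' [r [hr ->]]]; exists (b' + b), r; lia.
- by move=> [b' [r [hr ->]]]; exists (b' + b), r; lia.
- by move=> d [b' [r [hr -> ?]]]; exists (b' + b), r; split=> //; lia.
- by move=> d [b' [r [r' [hr hr' -> ?]]]]; exists (b' + b), r, r'; split=> //; lia.
Qed.

(** Membership of facts occurs only positively in [valid]. *)
Lemma valid_mono (c c' : config cell) x y f : (forall p, c p \subset c' p) -> valid c x y f -> valid c' x y f.
Proof.
move=> sub.
have S p g : g \in c p -> g \in c' p by move=> ?; apply: (subsetP (sub p)).
have H b a i : holds c b a i -> holds c' b a i.
  case: a => [|||] /=; rewrite /attached /chosen /satisfied.
  - exact: S.
  - by case=> *; split; apply: S.
  - move=> d [? [?|[j [? ? ?]]]]; split; [exact: S|by left|exact: S|right].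
    by exists j; split=> //; apply: S.
  - by move=> d; apply: S.
case: f => [l k|b|[] a] //=.
- by move=> [B [i [? ? ? P]]]; exists B, i; split=> // *; apply: S; apply: P.
- by move=> [B [i [r [? ? ? ? P]]]]; exists B, i, r; split=> //; apply: H.
- by move=> [B [i [r [? ? ? ? P]]]]; exists B, i, r; split=> //; apply: H.
Qed.

Lemma attached_chosen c b i : invariant c -> 0 <= i < M -> attached c b i -> chosen c b i.
Proof.
move=> I hi A; case: b A => bx by_ A.
have [[bx' by'] [i' [r [/= hi' hr E1 E2 [_ C]]]]] := inv_valid I A.
have [? ?] := block_injM hi hi' E1; have [? ?] := block_inj (row_bound hi) hr E2.
by subst.
Qed.

(** Choosing the larger of two entries requires that the smaller was passed over, which excludes
    that it was chosen. *)
Lemma chosen_uniq c b i i' : invariant c -> 0 <= i < m -> 0 <= i' < m ->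
  chosen c b i -> chosen c b i' -> i = i'.
Proof.
move=> I; wlog: i i' / i < i' => [W hi hi' C C'|lt hi hi' C C'].
  by case: (Z.lt_trichotomy i i') => [?|[//|?]]; [|symmetry]; apply: W.
have [[bx by_] [i'' [/= hi'' E1 E2 P]]] := inv_valid I C'.
have [? ?] := block_inj hi' hi'' E1.
have [? _] : b.2 = by_ /\ 0 = 0 by apply: block_inj; lia.
subst; have Q := P i.
by have := inv_choice I C; rewrite Q //; lia.
Qed.

Lemma attached_uniq c b i i' : invariant c -> 0 <= i < M -> 0 <= i' < M ->
  attached c b i -> attached c b i' -> i = i'.
Proof.
have := le_Mm => ? I hi hi' A A'.
by apply: (@chosen_uniq c b) => //; try lia; apply: attached_chosen.
Qed.

Lemma valid_crossing c x y k : invariant c -> crossing (c (x, y)) k ->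
  exists b i j, [/\ 0 <= i < M, 0 <= j < M, x = m * b.1 + i, y = m * b.2 + M * j &
                  table k (i - M * j)].
Proof.
move=> I [/(inv_valid I) [bx [i [hi /= ->]]] /(inv_valid I) [by_ [j [hj /= ->]]]
          /(inv_valid I) /= T].
exists (bx, by_), i, j; split=> //=.
by move/(@table_shift _ _ (by_ - bx)): T; congr table; lia.
Qed.

(** [Attached] is the exception: its validity asks for the fact at the home cell, so a fresh
    attachment becomes valid only once added. The second alternative keeps what justifies it. *)
Lemma rule_valid c x y f : invariant c -> derivable c x y f ->
  valid c x y f \/
  exists b i, [/\ f = Dyn Col Attached, (x, y) = home b i, 0 <= i < M,
                  chosen c b i & forall d, satisfied c b i d].
Proof.
move=> I H; have V x' y' g : g \in c (x', y') -> valid c x' y' g := @inv_valid _ I x' y' g.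
have mgt := m_gt0; have leM := le_Mm.
(* One case per rule, in the order of declaration. Block coordinates of different premises are
   identified by uniqueness of division with remainder. *)
inversion H; subst f.
- by left; apply: (V _ _ _ H0).
- by left; apply: (V _ _ _ H0).
- by left; apply: (V _ _ _ H0).
- by left; apply: (V _ _ _ H0).
- by left; move: (V _ _ _ H0) => /=; congr table; lia.
- by left; move: (V _ _ _ H0) => /=; congr table; lia.
- left; move: (V _ _ _ H0) (V _ _ _ H1) => /= T [b E].
  by move/(@table_shift _ _ (- b)): T; congr table; lia.
- left; move: (V _ _ _ H0) (V _ _ _ H1) => /= T [b E].
  by move/(@table_shift _ _ b): T; congr table; lia.
- left; move: (V _ _ _ H0) (V _ _ _ H1) => /= T [b E].
  by move/(@table_shift _ _ (- b)): T; congr table; lia.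
- left; move: (V _ _ _ H1) (V _ _ _ H2) => /= [by_ Ey] [bx Ex].
  by exists (bx, by_), 0; split=> //=; lia.
- left; move: (V _ _ _ H1) (V _ _ _ H2) (V _ _ _ H3) =>
    /= [by_ Ey] [bx [r [hr Ex]]] [[bx' by'] [i [/= hi Ex' Ey' P]]].
  have [? ?] : bx = bx' /\ r - 1 = i by apply: block_inj; lia.
  exists (bx', by'), r; split=> //=; [lia|lia|] => i' hi'.
  case: (Z.eq_dec i' i) => [->|ne]; last by apply: P; lia.
  by rewrite -Ex' -Ey'.
- left; move: (V _ _ _ H0) (V _ _ _ H1) =>
    /= [[bx by_] [i [r [/= hi hr Ex Ey P]]]] [b' [r' [hr' Ey']]].
  have [? ?] : b' = by_ /\ r' - 1 = r by apply: block_inj; lia.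
  by exists (bx, by_), i, r'; split=> //=; lia.
- left; move: (V _ _ _ H0) (V _ _ _ H1) =>
    /= [[bx by_] [i [r [/= hi hr Ex Ey P]]]] [b' [r' [hr' Ey']]].
  have [? ?] : b' = by_ /\ r' = r by apply: block_inj; lia.
  by exists (bx, by_), i, (r - 1); split=> //=; lia.
- left; move: (V _ _ _ H0) (V _ _ _ H1) =>
    /= [[bx by_] [i [r [/= hi hr Ex Ey P]]]] [b' [r' [hr' Ex']]].
  have [? ?] : b' = bx /\ r' - 1 = r by apply: block_inj; lia.
  by exists (bx, by_), i, r'; split=> //=; lia.
- left; move: (V _ _ _ H0) (V _ _ _ H1) =>
    /= [[bx by_] [i [r [/= hi hr Ex Ey P]]]] [b' [r' [hr' Ex']]].
  have [? ?] : b' = bx /\ r' = r by apply: block_inj; lia.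
  by exists (bx, by_), i, (r - 1); split=> //=; lia.
- left; have [b [i [j [hi hj Ex Ey /= [b' [i' [hi' E]]]]]]] := valid_crossing I H1.
  have [? ?] : i = i' /\ j = i' by apply: (@crossing_inj 0 b'); lia.
  have [b1 [i1 [r1 [hi1 hr1 Ex1 Ey1 P]]]] := V _ _ _ H0.
  have [e1 ei] := block_injM hi hi1 (etrans (esym Ex) Ex1).
  have [e2 _] := block_inj (row_bound hj) hr1 (etrans (esym Ey) Ey1).
  have ? : b = b1 by exact: pos_ext.
  by exists b1, i1, i1; subst; split=> //; lia.
- left; move: (V _ _ _ H0) (V _ _ _ H1) =>
    /= [b [i [hi Ex Ey P]]] [b' [i' [hi' Ex']]].
  have [? ?] : b.1 = b' /\ i = i' by apply: block_inj; lia.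
  exists b, i, 0; split; try lia.
  by rewrite /holds /chosen -Ex -Ey.
- left; have [b [i [j [hi hj Ex Ey /= [b' [i' [hi' E F]]]]]]] := valid_crossing I H1.
  have [? ?] : i = i' /\ j = i' by apply: (@crossing_inj 0 b'); lia.
  have [b1 [i1 [r1 [hi1 hr1 Ex1 Ey1 P]]]] := V _ _ _ H0.
  exists b1, i1, r1; split=> //; split=> //; left.
  by move: (Ex1); rewrite Ex => /(block_injM hi hi1) [_ <-]; subst.
- left; have [b [i [j [hi hj Ex Ey /= [b' [i' [j' [hi' hj' E F]]]]]]]] := valid_crossing I H2.
  have [? ?] : i = i' /\ j = j' by apply: (@crossing_inj 0 b'); lia.
  have [b1 [i1 [r1 [hi1 hr1 Ex1 Ey1 P]]]] := V _ _ _ H0.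
  have [b2 [j2 [r2 [hj2 hr2 Ex2 Ey2 Q]]]] := V _ _ _ H1.
  have hi0 : 0 <= i < m by lia.
  have [a1 a2] := block_injM hi hi1 (etrans (esym Ex) Ex1).
  have [a3 _] := block_inj (row_bound hj) hr1 (etrans (esym Ey) Ey1).
  have [a5 _] := block_inj hi0 hr2 (etrans (esym Ex) Ex2).
  have [a6 a7] := block_injMM hj hj2 (etrans (esym Ey) Ey2).
  exists b1, i1, r1; split=> //; split=> //; right; exists j2; split=> //.
    by subst.
  by have -> : b1 = b2 by apply: pos_ext; rewrite -?a1 -?a3.
- right; have [b [i [j [hi hj Ex Ey /= [b' [i' [hi' E]]]]]]] := valid_crossing I H1.
  have [? ?] : i = i' /\ j = i' by apply: (@crossing_inj 0 b'); lia.
  subst i j.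
  have Q d : holds c b (Met d) i'.
    have [b1 [i1 [r1 [hi1 hr1 Ex1 Ey1 P]]]] := V _ _ _ (H0 d).
    have [a1 a2] := block_injM hi hi1 (etrans (esym Ex) Ex1).
    have [a3 _] := block_inj (row_bound hj) hr1 (etrans (esym Ey) Ey1).
    have -> : b = b1 by exact: pos_ext.
    by rewrite a2.
  exists b, i'; split=> //; first by rewrite /home -Ex -Ey.
    by case: (Q DN).
  by move=> d; case: (Q d).
- left; move: (V _ _ _ H0) (V _ _ _ H1) =>
    /= [[bx by_] [i [r [/= hi hr Ex Ey [A _]]]]] [b' Ey'].
  have [? ?] : b' = by_ /\ 0 = r by apply: block_inj; lia.
  exists (bx, by_ - 1), i, (m - 1); split=> //=; try lia.
  by rewrite /addp /= Z.add_0_r Z.sub_add.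
- left; move: (V _ _ _ H0) (V _ _ _ H1) =>
    /= [[bx by_] [i [r [/= hi hr Ex Ey [A _]]]]] [b' Ey'].
  have [? ?] : b' - 1 = by_ /\ m - 1 = r by apply: block_inj; lia.
  exists (bx, by_ + 1), i, 0; split=> //=; try lia.
  by rewrite /addp /= Z.add_0_r -Z.add_assoc Z.add_0_r.
- left; move: (V _ _ _ H0) (V _ _ _ H1) =>
    /= [[bx by_] [i [r [/= hi hr Ex Ey [A _]]]]] [b' Ey'].
  have [? ?] : b' = bx /\ 0 = r by apply: block_inj; lia.
  exists (bx - 1, by_), i, (m - 1); split=> //=; try lia.
  by rewrite /addp /= Z.add_0_r Z.sub_add.
- left; move: (V _ _ _ H0) (V _ _ _ H1) =>
    /= [[bx by_] [i [r [/= hi hr Ex Ey [A _]]]]] [b' Ey'].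
  have [? ?] : b' - 1 = bx /\ m - 1 = r by apply: block_inj; lia.
  exists (bx + 1, by_), i, 0; split=> //=; try lia.
  by rewrite /addp /= -Z.add_assoc !Z.add_0_r.
Qed.

(** * Preservation of the invariant *)

Lemma step_sub (c c' : config cell) p : step c c' -> c p \subset c' p.
Proof.
move=> /stepP H; case: p => x y; case: (H x y) => [->|[f _ ->]] //; exact: subsetUr.
Qed.

Lemma step_valid c c' : invariant c -> step c c' ->
  forall x y f, f \in c' (x, y) -> valid c' x y f.
Proof.
move=> I st x y f fin; have sub p := step_sub p st.
case: (stepP c c') => /(_ st) H _; move: (fin).
case: (H x y) => [-> /(inv_valid I)|[g dg ->]]; first exact: valid_mono.
rewrite in_setU1 => /orP [/eqP ?|/(inv_valid I)]; last exact: valid_mono.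
subst g; case: (rule_valid I dg) => [|[b [i [Ef Ep hi C _]]]]; first exact: valid_mono.
subst f; case: Ep => Ex Ey; exists b, i, (M * i); split=> //; first exact: row_bound.
split; first by rewrite /attached /home -Ex -Ey.
exact: (subsetP (sub _)).
Qed.

(** A step adds at most one fact to a cell, and a [Scan] fact only where its opposite is absent. *)
Lemma step_choice c c' : invariant c -> step c c' ->
  forall p, Scan true \in c' p -> Scan false \notin c' p.
Proof.
move=> I /stepP st [x y]; have N := @inv_choice _ I (x, y).
case: (st x y) => [->//|[g dg ->]]; rewrite !in_setU1 !negb_or.
case: eqP => [?|_ /= inT]; [subst g => _|].
  by inversion dg; apply/andP; split.
rewrite N // andbT; apply/eqP => ?; subst g.
by inversion dg; match goal with h : is_true (_ \notin _) |- _ => rewrite /= inT in h end.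
Qed.

(** A cell with quiescent neighbourhood derives nothing, so the new support lies in the old one
    translated by the negated neighbourhood vectors. *)
Lemma step_finite c c' : finite_config set0 c -> step c c' -> finite_config set0 c'.
Proof.
move=> [D HD] st.
exists (List.flat_map (fun p => List.map (fun v => subp p v) (tval nbhd)) D) => [[x y]] ne.
case: (stepP c c') => /(_ st) /(_ x y) H _.
have N v : In v (tval nbhd) -> ~ In (x, y) (List.flat_map (fun p => List.map (fun v => subp p v) (tval nbhd)) D) -> c (addp (x, y) v) = set0.
  move=> hv nD; case: (pselect (c (addp (x, y) v) = set0)) => // h; case: nD.
  apply/in_flat_map; exists (addp (x, y) v); split; first exact: HD.
  apply/in_map_iff; exists v; split=> //.
  by rewrite /subp /addp /= !Z.add_simpl_r.
apply: contrapT => nD.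
have E v : In v (tval nbhd) -> c (addp (x, y) v) = set0 by move=> hv; apply: N.
have E0 := E (0, 0); have E1 := E (0, 1); have E2 := E (1, 0); have E3 := E (0, -1).
have E4 := E (-1, 0); have E5 := E (1, 1); have E6 := E (-1, -1).
move: E0 E1 E2 E3 E4 E5 E6; rewrite /addp /= !Z.add_0_r => E0 E1 E2 E3 E4 E5 E6.
case: H => [h|[f df _]]; first by apply: ne; rewrite h E0 //; tauto.
move: df; rewrite /derivable E0 ?E1 ?E2 ?E3 ?E4 ?E5 ?E6; try tauto.
exact: rule_quiescent.
Qed.

Lemma step_invariant c c' : invariant c -> step c c' -> invariant c'.
Proof.
move=> I st; split.
- exact: (step_valid I st).
- exact: (step_choice I st).
- exact: (step_finite (inv_finite I) st).
Qed.

Lemma reach_invariant c c' : invariant c -> reach c c' -> invariant c'.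
Proof.
move=> I [n]; elim: n c' => [c' -> //|n IH c' [z [/IH I' st]]].
exact: step_invariant I' st.
Qed.

Lemma reach_sub c c' p : reach c c' -> c p \subset c' p.
Proof.
move=> [n]; elim: n c' => [c' -> //|n IH c' [z [/IH s1 st]]].
exact: subset_trans s1 (step_sub _ st).
Qed.

(** The justification lies in [c], before the step, so simultaneous attachments do not rely on one
    another. *)
Lemma attached_step c c' b i : invariant c -> step c c' -> 0 <= i < M ->
  attached c' b i -> attached c b i \/ forall d, satisfied c b i d.
Proof.
move=> I /stepP st hi; rewrite /attached /home.
case: (st (m * b.1 + i) (m * b.2 + M * i)) => [->|[f df ->]]; first by left.
rewrite in_setU1 => /orP [/eqP ?|]; last by left.
subst f; case: (rule_valid I df) => [[b' [i' [r [hi' hr Ex Ey [A _]]]]]|].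
  have [e1 ?] := block_injM hi hi' Ex; have [e2 ?] := block_inj (row_bound hi) hr Ey.
  by left; subst; rewrite e1 e2.
move=> [b' [i' [_ [Ex Ey] hi' _ S]]].
have [e1 ?] := block_injM hi hi' Ex; have [e2 ?] := block_injMM hi hi' Ey.
have -> : b = b' by exact: pos_ext.
by right; subst.
Qed.

(** * Extensions without new choices or attachments *)

(** [ext_attached] looks at home cells only, so copies of [Attached] may still spread. *)
Record extends (c c' : config cell) : Prop := Extends {
  ext_reach : reach c c';
  ext_scan : forall p b, Scan b \in c' p -> Scan b \in c p;
  ext_attached : forall b i, 0 <= i < M -> attached c' b i -> attached c b i }.

Lemma extends_refl c : extends c c.
Proof. by split=> //; apply: reach_refl. Qed.

Lemma extends_trans c1 c2 c3 : extends c1 c2 -> extends c2 c3 -> extends c1 c3.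
Proof.
case=> r1 s1 a1 [r2 s2 a2]; split; first exact: reach_trans r1 r2.
- by move=> p b /s2 /s1.
- by move=> b i hi /(a2 _ _ hi) /(a1 _ _ hi).
Qed.

(* Forcing over extensions that keep the choices and attachments: facts of this kind
   can be accumulated without deciding anything about the assembly. *)
Definition forced (c : config cell) (x y : Z) (f : fact) : Prop :=
  forall c1, extends c c1 -> exists2 c2, extends c1 c2 & f \in c2 (x, y).

Fixpoint every (T : Type) (P : T -> Prop) (s : seq T) : Prop :=
  if s is x :: s' then P x /\ every P s' else True.

Definition known (c : config cell) (q : Z * Z * fact) : Prop := q.2 \in c q.1.

Definition knowable (c : config cell) (q : Z * Z * fact) : Prop :=
  forced c q.1.1 q.1.2 q.2.

(** Forced facts are realised one after another; those already obtained are never lost. *)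
Lemma forced_every c ps : every (knowable c) ps ->
  forall c1, extends c c1 -> exists2 c2, extends c1 c2 & every (known c2) ps.
Proof.
elim: ps => [_ c1 _|[[x y] f] ps IH /= [H Hs] c1 e1]; first by exists c1; [exact: extends_refl|].
have [c2 e2 H2] := H _ e1.
have [c3 e3 H3] := IH Hs _ (extends_trans e1 e2).
exists c3; first exact: extends_trans e2 e3.
by split=> //; apply: (subsetP (reach_sub _ (ext_reach e3))).
Qed.

Lemma forced_in (c : config cell) x y f : f \in c (x, y) -> forced c x y f.
Proof.
move=> H c1 e1; exists c1; first exact: extends_refl.
exact: (subsetP (reach_sub _ (ext_reach e1))).
Qed.

Lemma forced_rule c x y f ps : every (knowable c) ps ->
  (forall c', every (known c') ps -> derivable c' x y f) ->
  valid c x y f -> (forall b, f <> Scan b) -> forced c x y f.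
Proof.
move=> H R V nS c1 e1; have [c2 e2 H2] := forced_every H e1.
exists (add_fact c2 x y f); last by apply/in_add_fact; right.
apply: (extends_trans e2); split; first by apply: reach_add; apply: R.
- by move=> p b /in_add_fact [//|[/esym /nS]].
(* If [f] is [Attached] at a home cell, its validity in [c] says that the attachment is already
   there. *)
move=> b i hi /in_add_fact [//|[Ef [Ex Ey]]]; subst f.
case: V => b' [i' [r [hi' hr Ex' Ey' [A _]]]].
have [e1' ?] := block_injM hi hi' (etrans Ex Ex').
have [e2' ?] := block_inj (row_bound hi) hr (etrans Ey Ey').
have -> : b = b' by exact: pos_ext.
subst i'; apply: (subsetP (reach_sub _ (ext_reach e2))).
exact: (subsetP (reach_sub _ (ext_reach e1))).
Qed.

(** * Spread of the static words from a finite square to the plane *)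

(** The square contains a full period of columns and meets the three diagonals x - y = -m, 0, m,
    which lead to the adjacent blocks. *)
Definition based (c : config cell) : Prop :=
  forall l k x y, - m <= x <= m -> - m <= y <= m -> table k (coord l x y) ->
  Static l k \in c (x, y).

Lemma Z_spread (P : Z -> Prop) x0 : P x0 -> (forall x, P x -> P (x + 1)) ->
  (forall x, P x -> P (x - 1)) -> forall x, P x.
Proof.
move=> P0 Pp Pm x.
have up (n : nat) : P (x0 + Z.of_nat n).
  elim: n => [|n IH]; first by rewrite Z.add_0_r.
  have -> : x0 + Z.of_nat n.+1 = x0 + Z.of_nat n + 1 by lia.
  exact: Pp.
have down (n : nat) : P (x0 - Z.of_nat n).
  elim: n => [|n IH]; first by rewrite Z.sub_0_r.
  have -> : x0 - Z.of_nat n.+1 = x0 - Z.of_nat n - 1 by lia.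
  exact: Pm.
case: (Z.le_gt_cases x0 x) => h.
  by have -> : x = x0 + Z.of_nat (Z.to_nat (x - x0)) by lia.
by have -> : x = x0 - Z.of_nat (Z.to_nat (x0 - x)) by lia.
Qed.

Lemma Z_spread_range (P : Z -> Prop) r r' n : 0 <= r < n -> 0 <= r' < n -> P r ->
  (forall x, 0 <= x -> x + 1 < n -> P x -> P (x + 1)) ->
  (forall x, 0 < x < n -> P x -> P (x - 1)) -> P r'.
Proof.
move=> hr hr' Pr Pp Pm.
have up (k : nat) : r + Z.of_nat k < n -> P (r + Z.of_nat k).
  elim: k => [|k IH] h; first by rewrite Z.add_0_r.
  have -> : r + Z.of_nat k.+1 = r + Z.of_nat k + 1 by lia.
  by apply: Pp; [lia|lia|apply: IH; lia].
have down (k : nat) : 0 <= r - Z.of_nat k -> P (r - Z.of_nat k).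
  elim: k => [|k IH] h; first by rewrite Z.sub_0_r.
  have -> : r - Z.of_nat k.+1 = r - Z.of_nat k - 1 by lia.
  by apply: Pm; [lia|apply: IH; lia].
case: (Z.le_gt_cases r r') => h.
  have -> : r' = r + Z.of_nat (Z.to_nat (r' - r)) by lia.
  apply: up; lia.
have -> : r' = r - Z.of_nat (Z.to_nat (r - r')) by lia.
apply: down; lia.
Qed.

Section Forcing.
Variables (c : config cell).
Hypotheses (I : invariant c) (B : based c).

Lemma forced_row x0 y k : table k y -> forced c x0 y (Static Row k) ->
  forall x, forced c x y (Static Row k).
Proof.
move=> T H0; apply: Z_spread H0 _ _ => x H.
  apply: (@forced_rule _ _ _ _ [:: (x, y, Static Row k)]) => // c' [h _].
  by apply: row_from_west; rewrite Z.add_simpl_r.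
apply: (@forced_rule _ _ _ _ [:: (x, y, Static Row k)]) => // c' [h _].
by apply: row_from_east; rewrite Z.sub_add.
Qed.

Lemma forced_col x y0 k : table k x -> forced c x y0 (Static Col k) ->
  forall y, forced c x y (Static Col k).
Proof.
move=> T H0; apply: Z_spread H0 _ _ => y H.
  apply: (@forced_rule _ _ _ _ [:: (x, y, Static Col k)]) => // c' [h _].
  by apply: col_from_south; rewrite Z.add_simpl_r.
apply: (@forced_rule _ _ _ _ [:: (x, y, Static Col k)]) => // c' [h _].
by apply: col_from_north; rewrite Z.sub_add.
Qed.

Lemma forced_diag x y k : table k (x - y) -> forced c x y (Static Diag k) ->
  forall z, forced c (x + z) (y + z) (Static Diag k).
Proof.
move=> T H0.
have H0' : forced c (x + 0) (y + 0) (Static Diag k) by rewrite !Z.add_0_r.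
have E z : x + z - (y + z) = x - y by lia.
apply: (Z_spread (P := fun z => forced c (x + z) (y + z) (Static Diag k))) H0' _ _ => z H.
  apply: (@forced_rule _ _ _ _ [:: (x + z, y + z, Static Diag k)]) => // [c' [h _]|].
    by apply: diag_from_sw; rewrite !Z.add_assoc !Z.add_simpl_r.
  by rewrite /= E.
apply: (@forced_rule _ _ _ _ [:: (x + z, y + z, Static Diag k)]) => // [c' [h _]|].
  by apply: diag_from_ne; rewrite !Z.add_sub_assoc !Z.sub_add.
by rewrite /= E.
Qed.

Definition row_forced (y : Z) : Prop :=
  forall x k, table k y -> forced c x y (Static Row k).
Definition col_forced (x : Z) : Prop :=
  forall y k, table k x -> forced c x y (Static Col k).

Lemma col_forced_base x : - m <= x <= m -> col_forced x.
Proof.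
move=> hx y k T; apply: (@forced_col _ 0) => //; apply/forced_in/B => //.
have := m_gt0; lia.
Qed.

Lemma diag_zero_forced b y : - 1 <= b <= 1 -> forced c (y + m * b) y (Static Diag Zero).
Proof.
move=> hb; have T : table Zero (m * b - 0) by exists b; lia.
have := @forced_diag (m * b) 0 Zero T; rewrite Z.add_comm => H; apply: (H _ y).
by apply/forced_in/B => //; have := m_gt0; nia.
Qed.

(** Row y and column y + m b meet on the diagonal x - y = m b, where one word turns into the
    other. *)
Lemma col_of_row y b : - 1 <= b <= 1 -> row_forced y -> col_forced (y + m * b).
Proof.
move=> hb R y' k T; apply: (@forced_col _ y) => //.
have T' : table k y by move/(@table_shift _ _ (- b)): T; congr table; lia.
apply: (@forced_rule _ _ _ _ [:: (y + m * b, y, Static Row k); (y + m * b, y, Static Diag Zero)]) => //.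
  by split; [exact: R|split=> //; exact: diag_zero_forced].
by move=> c' [h1 [h2 _]]; apply: col_from_row.
Qed.

Lemma row_of_col x : col_forced x -> row_forced x.
Proof.
move=> C x' k T; apply: (@forced_row x) => //.
apply: (@forced_rule _ _ _ _ [:: (x, x, Static Col k); (x, x, Static Diag Zero)]) => //.
  split; first exact: C.
  by split=> //; have := @diag_zero_forced 0 x; rewrite Z.mul_0_r Z.add_0_r; apply; lia.
by move=> c' [h1 [h2 _]]; apply: row_from_col.
Qed.

(** A zigzag: column x turns into row x on the main diagonal, and row x into column x + m or x - m
    on a neighbouring one. The induction on the block index starts from the columns of the
    square. *)
Lemma col_forced_all x : col_forced x.
Proof.
have mgt := m_gt0; have := Z.mod_pos_bound x m mgt; have := Z.div_mod x m.
move: (x mod m) (x / m) => r b E hr; rewrite E; last by lia.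
move: b {E}; apply: (@Z_spread _ 0) => [|b H|b H].
- by apply: col_forced_base; lia.
- have -> : m * (b + 1) + r = m * b + r + m * 1 by lia.
  by apply: col_of_row; [lia|apply: row_of_col].
- have -> : m * (b - 1) + r = m * b + r + m * (-1) by lia.
  by apply: col_of_row; [lia|apply: row_of_col].
Qed.

Lemma forced_static l k x y : table k (coord l x y) -> forced c x y (Static l k).
Proof.
have R z : row_forced z := row_of_col (@col_forced_all z).
case: l => /= T; [exact: R|exact: col_forced_all|].
(* On the line y = 0 the diagonal and column coordinates agree, so the column word can be copied
   there. *)
suff H0 : forced c (x - y) 0 (Static Diag k).
  by have := @forced_diag (x - y) 0 k; rewrite Z.sub_0_r => /(_ T H0 y); rewrite Z.sub_add.
apply: (@forced_rule _ _ _ _ [:: (x - y, 0, Static Col k); (x - y, 0, Static Row Zero)]) => //.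
- by split; [exact: col_forced_all|split=> //; apply: R; exists 0; rewrite Z.mul_0_r].
- by move=> c' [h1 [h2 _]]; apply: diag_from_col.
- by rewrite /= Z.sub_0_r.
Qed.

Definition crossing_facts (x y : Z) (k : attr) : seq (Z * Z * fact) :=
  [:: (x, y, Static Col ColPort); (x, y, Static Row RowPort); (x, y, Static Diag k)].

Lemma crossing_knowable b i j k : 0 <= i < M -> 0 <= j < M -> table k (i - M * j) ->
  every (knowable c) (crossing_facts (m * b.1 + i) (m * b.2 + M * j) k).
Proof.
move=> hi hj T; split; [|split; [|split=> //]]; apply: forced_static => /=.
- by exists b.1, i.
- by exists b.2, j.
- by move/(@table_shift _ _ (b.1 - b.2)): T; congr table; lia.
Qed.

Lemma crossing_known c' x y k : every (known c') (crossing_facts x y k) ->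
  crossing (c' (x, y)) k.
Proof. by case=> ? [? [? _]]. Qed.

Lemma table_same i : 0 <= i < M -> table Same (i - M * i).
Proof. by move=> hi; exists 0, i; split=> //; rewrite Z.mul_0_r. Qed.

(** * Transport of claims within a block and between neighbours *)

Lemma spread_col b a i r r' : 0 <= i < M -> holds c b a i -> 0 <= r < m -> 0 <= r' < m ->
  forced c (m * b.1 + i) (m * b.2 + r) (Dyn Col a) ->
  forced c (m * b.1 + i) (m * b.2 + r') (Dyn Col a).
Proof.
move=> hi H hr hr' F0.
pose P r := forced c (m * b.1 + i) (m * b.2 + r) (Dyn Col a).
apply: (@Z_spread_range P r r' m hr hr' F0) => z hz.
- move=> hz' F; rewrite /P.
  apply: (@forced_rule _ _ _ _ [:: (m * b.1 + i, m * b.2 + z, Dyn Col a);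
      (m * b.1 + i, m * b.2 + (z + 1), Static Row NonZero)]) => //.
  + split=> //; split=> //; apply: forced_static => /=; exists b.2, (z + 1); lia.
  + move=> c' [h1 [h2 _]]; apply: move_up => //.
    by rewrite Z.add_assoc Z.add_simpl_r.
  + by exists b, i, (z + 1); split=> //; lia.
- move=> F; rewrite /P.
  apply: (@forced_rule _ _ _ _ [:: (m * b.1 + i, m * b.2 + z, Dyn Col a);
      (m * b.1 + i, m * b.2 + z, Static Row NonZero)]) => //.
  + split=> //; split=> //; apply: forced_static => /=; exists b.2, z; lia.
  + by move=> c' [h1 [h2 _]]; apply: move_down; rewrite Z.add_sub_assoc Z.sub_add.
  + by exists b, i, (z - 1); split=> //; lia.
Qed.

Lemma spread_row b a i r r' : 0 <= i < M -> holds c b a i -> 0 <= r < m -> 0 <= r' < m ->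
  forced c (m * b.1 + r) (m * b.2 + M * i) (Dyn Row a) ->
  forced c (m * b.1 + r') (m * b.2 + M * i) (Dyn Row a).
Proof.
move=> hi H hr hr' F0.
pose P r := forced c (m * b.1 + r) (m * b.2 + M * i) (Dyn Row a).
apply: (@Z_spread_range P r r' m hr hr' F0) => z hz.
- move=> hz' F; rewrite /P.
  apply: (@forced_rule _ _ _ _ [:: (m * b.1 + z, m * b.2 + M * i, Dyn Row a);
      (m * b.1 + (z + 1), m * b.2 + M * i, Static Col NonZero)]) => //.
  + split=> //; split=> //; apply: forced_static => /=; exists b.1, (z + 1); lia.
  + move=> c' [h1 [h2 _]]; apply: move_right => //.
    by rewrite Z.add_assoc Z.add_simpl_r.
  + by exists b, i, (z + 1); split=> //; lia.
- move=> F; rewrite /P.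
  apply: (@forced_rule _ _ _ _ [:: (m * b.1 + z, m * b.2 + M * i, Dyn Row a);
      (m * b.1 + z, m * b.2 + M * i, Static Col NonZero)]) => //.
  + split=> //; split=> //; apply: forced_static => /=; exists b.1, z; lia.
  + by move=> c' [h1 [h2 _]]; apply: move_left; rewrite Z.add_sub_assoc Z.sub_add.
  + by exists b, i, (z - 1); split=> //; lia.
Qed.

(** The claim moves along the column to the home cell, turns there, and moves along the row. *)
Lemma col_to_row b a i r r' : 0 <= i < M -> holds c b a i -> 0 <= r < m -> 0 <= r' < m ->
  forced c (m * b.1 + i) (m * b.2 + r) (Dyn Col a) ->
  forced c (m * b.1 + r') (m * b.2 + M * i) (Dyn Row a).
Proof.
move=> hi H hr hr' /(spread_col hi H hr (row_bound hi)) F.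
have leM := le_Mm.
apply: (@spread_row b a i i r') => //; first by lia.
apply: (@forced_rule _ _ _ _ ((m * b.1 + i, m * b.2 + M * i, Dyn Col a) ::
   crossing_facts (m * b.1 + i) (m * b.2 + M * i) Same)) => //.
- by split=> //; apply: crossing_knowable => //; apply: table_same.
- by move=> c' [h /crossing_known X]; apply: turn.
- by exists b, i, i; split=> //; lia.
Qed.

Lemma forced_attached_col b i r : 0 <= i < M -> attached c b i -> 0 <= r < m ->
  forced c (m * b.1 + i) (m * b.2 + r) (Dyn Col Attached).
Proof.
move=> hi A hr; apply: (@spread_col b Attached i (M * i)) => //; last exact: forced_in.
- by split=> //; apply: attached_chosen.
- exact: row_bound.
Qed.

Lemma forced_attached_row b i r : 0 <= i < M -> attached c b i -> 0 <= r < m ->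
  forced c (m * b.1 + r) (m * b.2 + M * i) (Dyn Row Attached).
Proof.
move=> hi A hr; apply: (@col_to_row b Attached i 0) => //.
- by split=> //; apply: attached_chosen.
- have := m_gt0; lia.
- by apply: forced_attached_col => //; have := m_gt0; lia.
Qed.

(** News from north or south crosses the boundary in a column and then has to turn into a row; news
    from east or west arrives in its row. It enters on the line facing the neighbour, at offset m -
    1 or 0. *)
Lemma forced_beside b d j r : 0 <= j < M -> attached c (addp b (dvec d)) j -> 0 <= r < m ->
  forced c (m * b.1 + r) (m * b.2 + M * j) (Dyn Row (Beside d)).
Proof.
move=> hj A hr; have mgt := m_gt0.
case: d A => A; move: (A); rewrite /addp /= ?Z.add_0_r => A'.
- apply: (@col_to_row b (Beside DN) j (m - 1)) => //; first by lia.
  have := forced_attached_col (r := 0) hj A'; rewrite /= => F.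
  apply: (@forced_rule _ _ _ _ [:: (m * b.1 + j, m * (b.2 + 1) + 0, Dyn Col Attached);
    (m * b.1 + j, m * (b.2 + 1) + 0, Static Row Zero)]) => //.
  + split; first by apply: F; lia.
    by split=> //; apply: forced_static; exists (b.2 + 1); rewrite /= Z.add_0_r.
  + move=> c' [h1 [h2 _]]; apply: beside_north.
      by have -> : m * b.2 + (m - 1) + 1 = m * (b.2 + 1) + 0 by lia.
    by have -> : m * b.2 + (m - 1) + 1 = m * (b.2 + 1) + 0 by lia.
  + by exists b, j, (m - 1); split=> //; lia.
- apply: (@spread_row b (Beside DE) j (m - 1)) => //; first by lia.
  have := forced_attached_row (r := 0) hj A'; rewrite /= => F.
  apply: (@forced_rule _ _ _ _ [:: (m * (b.1 + 1) + 0, m * b.2 + M * j, Dyn Row Attached);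
    (m * (b.1 + 1) + 0, m * b.2 + M * j, Static Col Zero)]) => //.
  + split; first by apply: F; lia.
    by split=> //; apply: forced_static; exists (b.1 + 1); rewrite /= Z.add_0_r.
  + move=> c' [h1 [h2 _]]; apply: beside_east.
      by have -> : m * b.1 + (m - 1) + 1 = m * (b.1 + 1) + 0 by lia.
    by have -> : m * b.1 + (m - 1) + 1 = m * (b.1 + 1) + 0 by lia.
  + by exists b, j, (m - 1); split=> //; lia.
- apply: (@col_to_row b (Beside DS) j 0) => //.
  have := forced_attached_col (r := m - 1) hj A'; rewrite /= => F.
  apply: (@forced_rule _ _ _ _ [:: (m * b.1 + j, m * (b.2 + -1) + (m - 1), Dyn Col Attached);
    (m * b.1 + j, m * b.2 + 0, Static Row Zero)]) => //.
  + split; first by apply: F; lia.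
    by split=> //; apply: forced_static; exists b.2; rewrite /= Z.add_0_r.
  + move=> c' [h1 [h2 _]]; apply: beside_south => //.
    by have -> : m * b.2 + 0 - 1 = m * (b.2 + -1) + (m - 1) by lia.
  + by exists b, j, 0; split=> //; lia.
- apply: (@spread_row b (Beside DW) j 0) => //.
  have := forced_attached_row (r := m - 1) hj A'; rewrite /= => F.
  apply: (@forced_rule _ _ _ _ [:: (m * (b.1 + -1) + (m - 1), m * b.2 + M * j, Dyn Row Attached);
    (m * b.1 + 0, m * b.2 + M * j, Static Col Zero)]) => //.
  + split; first by apply: F; lia.
    by split=> //; apply: forced_static; exists b.1; rewrite /= Z.add_0_r.
  + move=> c' [h1 [h2 _]]; apply: beside_west => //.
    by have -> : m * b.1 + 0 - 1 = m * (b.1 + -1) + (m - 1) by lia.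
  + by exists b, j, 0; split=> //; lia.
Qed.

Lemma forced_selected b i r : 0 <= i < M -> chosen c b i -> 0 <= r < m ->
  forced c (m * b.1 + i) (m * b.2 + r) (Dyn Col Selected).
Proof.
move=> hi C hr; have mgt := m_gt0.
apply: (@spread_col b Selected i 0) => //.
rewrite Z.add_0_r.
apply: (@forced_rule _ _ _ _ [:: (m * b.1 + i, m * b.2, Scan true);
  (m * b.1 + i, m * b.2, Static Col ColPort)]) => //.
- split; first exact: forced_in.
  by split=> //; apply: forced_static; exists b.1, i.
- by move=> c' [h1 [h2 _]]; apply: select.
- by exists b, i, 0; split=> //; lia.
Qed.

Lemma forced_met b i d : 0 <= i < M -> chosen c b i -> satisfied c b i d ->
  forced c (m * b.1 + i) (m * b.2 + M * i) (Dyn Col (Met d)).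
Proof.
move=> hi C S; have leM := le_Mm; case: (S) => [f|[j [hj R A]]].
  apply: (@forced_rule _ _ _ _ ((m * b.1 + i, m * b.2 + M * i, Dyn Col Selected) ::
     crossing_facts (m * b.1 + i) (m * b.2 + M * i) (Free d))) => //.
  - split; first by apply: forced_selected => //; apply: row_bound.
    by apply: crossing_knowable => //; exists 0, i; split=> //; rewrite Z.mul_0_r.
  - by move=> c' [h /crossing_known X]; apply: met_free.
  - by exists b, i, (M * i); split=> //; apply: row_bound.
(* Compatibility of i with j is tested where column i meets row M j; the result then travels along
   column i to the home cell. *)
apply: (@spread_col b (Met d) i (M * j)) => //; try exact: row_bound.
apply: (@forced_rule _ _ _ _ ((m * b.1 + i, m * b.2 + M * j, Dyn Col Selected) ::
   (m * b.1 + i, m * b.2 + M * j, Dyn Row (Beside d)) ::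
   crossing_facts (m * b.1 + i) (m * b.2 + M * j) (Compat d))) => //.
- split; first by apply: forced_selected => //; apply: row_bound.
  split; first by apply: forced_beside => //; lia.
  by apply: crossing_knowable => //; exists 0, i, j; split=> //; rewrite Z.mul_0_r.
- by move=> c' [h [h' /crossing_known X]]; apply: met_compat.
- by exists b, i, (M * j); split=> //; apply: row_bound.
Qed.

(** * Attaching and choosing an entry *)

(** The premises of [attach_tile] are all forced, hence hold together in one extension; the fact
    added after it is the only new attachment. *)
Lemma attach_reach b i : 0 <= i < M -> chosen c b i -> (forall d, satisfied c b i d) ->
  exists c', [/\ reach c c', attached c' b i,
    forall b' i', 0 <= i' < M -> attached c' b' i' -> attached c b' i' \/ (b' = b /\ i' = i) &
    forall p s, Scan s \in c' p -> Scan s \in c p].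
Proof.
move=> hi C S; pose x := m * b.1 + i; pose y := m * b.2 + M * i.
have [|c1 e1 H] := @forced_every c (crossing_facts x y Same ++
  [:: (x, y, Dyn Col (Met DN)); (x, y, Dyn Col (Met DE));
      (x, y, Dyn Col (Met DS)); (x, y, Dyn Col (Met DW))]) _ _ (extends_refl c).
  have [? [? [? _]]] := @crossing_knowable b i i Same hi hi (table_same hi).
  by do !split=> //; apply: forced_met.
have D : derivable c1 x y (Dyn Col Attached).
  case: H => ? [? [? [? [? [? [? _]]]]]]; apply: attach_tile => //.
  by case.
exists (add_fact c1 x y (Dyn Col Attached)); split.
- exact: reach_trans (ext_reach e1) (reach_add D).
- by apply/in_add_fact; right.
- move=> b' i' hi' /in_add_fact [/(ext_attached e1 hi')|[_ [Ex Ey]]]; first by left.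
  have [e ei] := block_injM hi' hi Ex; have [e' _] := block_injMM hi' hi Ey.
  by right; split=> //; apply: pos_ext.
- by move=> p s /in_add_fact [/(ext_scan e1)|[]].
Qed.
End Forcing.

Lemma based_sub (c c' : config cell) : (forall p, c p \subset c' p) -> based c -> based c'.
Proof. by move=> sub B l k x y hx hy T; apply: (subsetP (sub _)); apply: B. Qed.

Lemma place_scan c b k s : invariant c -> based c -> 0 <= k < m ->
  (forall i, 0 <= i < k -> Scan false \in c (m * b.1 + i, m * b.2)) ->
  Scan (~~ s) \notin c (m * b.1 + k, m * b.2) ->
  exists c', [/\ reach c c', Scan s \in c' (m * b.1 + k, m * b.2),
    forall p s', Scan s' \in c' p ->
      Scan s' \in c p \/ (s' = s /\ p = (m * b.1 + k, m * b.2)) &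
    forall b' i, 0 <= i < M -> attached c' b' i -> attached c b' i].
Proof.
move=> I B hk P N; pose x := m * b.1 + k; pose y := m * b.2.
(* The first column of a block starts the scan; every other column continues it from its left
   neighbour. *)
pose z := if Z.eq_dec k 0 then Zero else NonZero.
have [|c1 e1 [Hy [Hx _]]] := @forced_every c
    [:: (x, y, Static Row Zero); (x, y, Static Col z)] _ _ (extends_refl c).
  split; first by apply: forced_static => //; exists b.2.
  split=> //; apply: forced_static => //; rewrite /z /= /x.
  by case: Z.eq_dec => h; [exists b.1; lia|exists b.1, k; lia].
have N1 : Scan (~~ s) \notin c1 (x, y) by apply: contra N => /(ext_scan e1).
have D : derivable c1 x y (Scan s).
  move: Hx; rewrite /known /z /=; case: Z.eq_dec => h Hx; first exact: choice_first.
  apply: choice_next => //; apply: (subsetP (reach_sub _ (ext_reach e1))).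
  by rewrite /x -Z.add_sub_assoc; apply: P; lia.
exists (add_fact c1 x y (Scan s)); split.
- exact: reach_trans (ext_reach e1) (reach_add D).
- by apply/in_add_fact; right.
- by move=> p s' /in_add_fact [/(ext_scan e1)|[[->] ->]]; [left|right].
- by move=> b' i hi /in_add_fact [/(ext_attached e1 hi)|[]].
Qed.

Lemma choose_reach c b i : invariant c -> based c -> 0 <= i < m ->
  (forall s k, 0 <= k < m -> Scan s \notin c (m * b.1 + k, m * b.2)) ->
  exists c', [/\ reach c c', chosen c' b i,
    forall p s, Scan s \in c' p ->
      Scan s \in c p \/ exists2 k, 0 <= k < m & p = (m * b.1 + k, m * b.2) &
    forall b' i, 0 <= i < M -> attached c' b' i -> attached c b' i].
Proof.
move=> I B hi N.
(* Entries before i are passed over one by one, which keeps the cell of i free for the choice. *)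
have skip (n : nat) : Z.of_nat n <= i -> exists c', [/\ reach c c',
    forall k, 0 <= k < Z.of_nat n -> Scan false \in c' (m * b.1 + k, m * b.2),
    forall p s, Scan s \in c' p ->
      Scan s \in c p \/ exists2 k, 0 <= k < Z.of_nat n & p = (m * b.1 + k, m * b.2) &
    forall b' i, 0 <= i < M -> attached c' b' i -> attached c b' i].
  elim: n => [|n IH] hn.
    exists c; split=> //; [exact: reach_refl|by move=> k; lia|by left].
  have [|c1 [r1 P1 S1 A1]] := IH; first by lia.
  have sub1 p := reach_sub p r1.
  have [|||||c2 [r2 P2 S2 A2]] := @place_scan c1 b (Z.of_nat n) false.
  - exact: reach_invariant r1.
  - exact: based_sub sub1 B.
  - lia.
  - exact: P1.
  - apply/negP => /S1 [|[k hk [E]]]; last by lia.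
    by apply/negP; apply: N; lia.
  exists c2; split.
  - exact: reach_trans r1 r2.
  - move=> k hk; case: (Z.eq_dec k (Z.of_nat n)) => [->//|ne].
    by apply: (subsetP (reach_sub _ r2)); apply: P1; lia.
  - move=> p s /S2 [/S1 [|[k hk ->]]|[_ ->]]; [by left|right|right].
      by exists k => //; lia.
    by exists (Z.of_nat n) => //; lia.
  - by move=> b' j hj /(A2 _ _ hj) /(A1 _ _ hj).
have [|c1 [r1 P1 S1 A1]] := skip (Z.to_nat i); first by lia.
have sub1 p := reach_sub p r1.
have [|||||c2 [r2 P2 S2 A2]] := @place_scan c1 b i true.
- exact: reach_invariant r1.
- exact: based_sub sub1 B.
- exact: hi.
- by move=> k hk; apply: P1; lia.
- apply/negP => /S1 [|[k hk [E]]]; last by lia.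
  by apply/negP; apply: N; lia.
exists c2; split=> //.
- exact: reach_trans r1 r2.
- move=> p s /S2 [/S1 [|[k hk ->]]|[_ ->]]; [by left|right|right].
    by exists k => //; lia.
  by exists i.
- by move=> b' j hj /(A2 _ _ hj) /(A1 _ _ hj).
Qed.
End Blocks.

(** * Encoding a tile system by entries *)

Section Tiles.
Local Open Scope Z_scope.

Variables (T : list tile) (tau : nat).

Definition entry := (tile * (nat * nat * nat * nat))%type.

Definition strength (e : entry) (d : dir) : nat :=
  let: (_, (kN, kE, kS, kW)) := e in
  match d with DN => kN | DE => kE | DS => kS | DW => kW end.

Definition total (e : entry) : nat :=
  (strength e DN + strength e DE + strength e DS + strength e DW)%N.

(** Strengths beyond [tau] bring no further tile within reach of the threshold, so claims range over
    0, ..., [tau]. *)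
Definition entries : list entry :=
  let r := List.seq 0 tau.+1 in
  list_prod T (list_prod (list_prod (list_prod r r) r) r).

Definition width : nat := List.length entries.
Let M := Z.of_nat width.
Let m := Z.of_nat (width * width).

Definition entry_at (i : Z) : option entry := nth_error entries (Z.to_nat i).
Definition tile_at (i : Z) : option tile := omap fst (entry_at i).

(** The bound on [total] is built into this relation and into [compat_dir], so it is checked however
    a direction is met. *)
Definition free_dir (d : dir) (i : Z) : Prop :=
  exists e, [/\ entry_at i = Some e, strength e d = 0%N & (tau <= total e)%N].

Definition compat_dir (d : dir) (i j : Z) : Prop :=
  exists e t, [/\ entry_at i = Some e, tile_at j = Some t,
                  (strength e d <= bind_str e.1 d t)%N & (tau <= total e)%N].

Definition sound := invariant M m free_dir compat_dir.

Lemma port_x_proof (n : nat) (i : 'I_n) : (i < n * n)%N.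
Proof. by case: n i => [[]//|n] i; apply: (leq_trans (ltn_ord i)); rewrite leq_pmulr. Qed.

Lemma port_y_proof (n : nat) (i : 'I_n) : (n * i < n * n)%N.
Proof. by case: n i => [[]//|n] i; rewrite ltn_pmul2l. Qed.

Definition port_x (n : nat) (i : 'I_n) : 'I_(n * n) := Ordinal (port_x_proof i).
Definition port_y (n : nat) (i : 'I_n) : 'I_(n * n) := Ordinal (port_y_proof i).

(** Under the invariant at most one home cell of a block carries the fact, so [pick] has no real
    choice. *)
Definition read (B : block cell (width * width) (width * width)) : option tile :=
  if [pick i : 'I_width | Dyn Col Attached \in B (port_x i) (port_y i)] is Some i
  then tile_at (Z.of_nat i) else None.

Definition asm (c : config cell) : assembly := Rstar read (packc c).

Lemma mE : m = M * M.
Proof. by rewrite /m /M; lia. Qed.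

Lemma entry_at_lt i : 0 <= i < M -> exists e, entry_at i = Some e.
Proof.
move=> hi; rewrite /entry_at; case E: nth_error => [e|]; first by exists e.
by have /nth_error_None := E; rewrite /M /width in hi; lia.
Qed.

Lemma entry_in e : In e entries -> exists2 i, 0 <= i < M & entry_at i = Some e.
Proof.
move=> /(@In_nth_error _ _ _) [n E]; exists (Z.of_nat n); last by rewrite /entry_at Nat2Z.id.
have /nth_error_Some : nth_error entries n <> None by rewrite E.
by rewrite /M /width; lia.
Qed.

Lemma tile_at_in i t : tile_at i = Some t -> In t T.
Proof.
rewrite /tile_at /entry_at; case E: (nth_error _ _) => [[t' k]|] //= [<-].
by have /in_prod_iff [] := nth_error_In _ _ E.
Qed.

Lemma home_port (c : config cell) b (i : 'I_width) :
  packc c b (port_x i) (port_y i) = c (home M m b (Z.of_nat i)).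
Proof. by rewrite /packc /home /M /m; congr (c (_, _)); rewrite /=; lia. Qed.

Section Sound.
Variables (c : config cell).
Hypotheses (width_gt0 : 0 < M) (S : sound c).

Lemma asm_attached b i t : 0 <= i < M -> attached M m c b i -> tile_at i = Some t ->
  asm c b = Some t.
Proof.
move=> hi A E; have hi' : (Z.to_nat i < width)%N by rewrite /M in hi; lia.
have Ei : Z.of_nat (Ordinal hi') = i by rewrite /=; lia.
rewrite /asm /Rstar /read; case: pickP => [j|/(_ (Ordinal hi'))]; rewrite home_port.
  move=> A'; suff -> : Z.of_nat j = i by [].
  apply: (attached_uniq width_gt0 mE S _ hi A' A).
  by have := ltn_ord j; rewrite /M; lia.
by rewrite Ei A.
Qed.

Lemma asm_inv b t : asm c b = Some t ->
  exists i, [/\ 0 <= i < M, attached M m c b i & tile_at i = Some t].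
Proof.
rewrite /asm /Rstar /read; case: pickP => // j; rewrite home_port => A E.
by exists (Z.of_nat j); split=> //; have := ltn_ord j; rewrite /M; lia.
Qed.

Lemma asm_none b i : asm c b = None -> 0 <= i < M -> ~ attached M m c b i.
Proof.
move=> E hi A; have [e Ee] := entry_at_lt hi.
have Et : tile_at i = Some e.1 by rewrite /tile_at Ee.
by rewrite (asm_attached hi A Et) in E.
Qed.
End Sound.

(** * Claimed against actual binding strengths *)

Definition contribution (a : assembly) (b : pos) (t : tile) (d : dir) : nat :=
  if a (addp b (dvec d)) is Some t' then bind_str t d t' else 0%N.

Lemma str_atE a b t : str_at a b t =
  (contribution a b t DN + contribution a b t DE
   + contribution a b t DS + contribution a b t DW)%N.
Proof.
have -> : str_at a b t = (contribution a b t DN + (contribution a b t DE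
   + (contribution a b t DS + (contribution a b t DW + 0))))%N by [].
by rewrite addn0 !addnA.
Qed.

Lemma str_at_mono (a a' : assembly) b t :
  (forall p t', a p = Some t' -> a' p = Some t') -> (str_at a b t <= str_at a' b t)%N.
Proof.
move=> H; have C d : (contribution a b t d <= contribution a' b t d)%N.
  by rewrite /contribution; case E: (a _) => [t'|] //; rewrite (H _ _ E).
by rewrite !str_atE !leq_add.
Qed.

(** Each claim is at most the actual contribution of its side, and the claims total at least
    [tau]. *)
Lemma satisfied_strength c b i e : 0 < M -> sound c -> entry_at i = Some e ->
  (forall d, satisfied M m free_dir compat_dir c b i d) -> (tau <= str_at (asm c) b e.1)%N.
Proof.
move=> M0 S E sat; have tot : (tau <= total e)%N.
  by case: (sat DN) => [[e' [E' _ H]]|[j [_ [e' [t' [E' _ _ H]]] _]]];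
     move: H; rewrite E in E'; case: E' => ->.
apply: (leq_trans tot); rewrite str_atE.
suff C d : (strength e d <= contribution (asm c) b e.1 d)%N by rewrite /total !leq_add.
case: (sat d) => [[e' [E' H _]]|[j [hj [e' [t' [E' Et H _]]] A]]].
  by rewrite E in E'; case: E' => ->; rewrite H.
rewrite /contribution (asm_attached M0 S hj A Et).
by rewrite E in E'; case: E' => ->.
Qed.

(** The claims are the actual contributions cut off at [tau]. Their total still reaches [tau]:
    either one of them equals [tau], or all are exact. *)
Lemma strength_satisfied c b t : 0 < M -> sound c -> In t T ->
  (tau <= str_at (asm c) b t)%N ->
  exists i, [/\ 0 <= i < M, tile_at i = Some t &
                forall d, satisfied M m free_dir compat_dir c b i d].
Proof.
move=> M0 S hT H; pose k d := minn tau (contribution (asm c) b t d).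
pose e : entry := (t, (k DN, k DE, k DS, k DW)).
have se d : strength e d = k d by case: d.
have tot : (tau <= total e)%N by rewrite /total !se /k; rewrite str_atE in H; lia.
have kr d : In (k d) (List.seq 0 tau.+1) by apply/in_seq; rewrite /k; lia.
have [i hi Ei] : exists2 i, 0 <= i < M & entry_at i = Some e.
  by apply: entry_in; do ?apply/in_prod.
exists i; split=> //; first by rewrite /tile_at Ei.
move=> d; case: (posnP (k d)) => [k0|kpos]; first by left; exists e; rewrite se.
right; move: (kpos); rewrite /k /contribution; case E: (asm c _) => [t'|]; last by rewrite minn0.
have [j [hj A Et]] := asm_inv E.
move=> _; exists j; split=> //; exists e, t'; split=> //.
by rewrite se /k /contribution E geq_minr.
Qed.

(** * Automaton steps as assembly sequences *)

Lemma asm_step_mono c c' b t : 0 < M -> sound c -> step c c' ->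
  asm c b = Some t -> asm c' b = Some t.
Proof.
move=> M0 S st /asm_inv [i [hi A E]].
apply: (asm_attached M0 (step_invariant M0 mE S st) hi _ E).
exact: (subsetP (step_sub _ st)).
Qed.

Lemma asm_finite c : 0 < M -> sound c -> exists L : list pos, forall b, asm c b <> None -> In b L.
Proof.
move=> M0 S; have [D HD] := inv_finite S.
exists (List.map (fun p => (p.1 / m, p.2 / m)) D) => b.
case E: (asm c b) => [t|] // _; have [i [hi A _]] := asm_inv E.
apply/in_map_iff; exists (home M m b i); split; last first.
  by apply: HD => h; move: A; rewrite /attached h inE.
have r := row_bound M0 mE hi; have l := le_Mm M0 mE.
apply: pos_ext => /=; rewrite Z.mul_comm Z.div_add_l; try lia.
  by rewrite Z.div_small; lia.
by rewrite Z.div_small; lia.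
Qed.

(** Finitely many blocks change, and they are updated one at a time, [mix L] having those in [L]
    updated. Each new tile is justified by its neighbours in [c], and further tiles only raise its
    binding strength. *)
Lemma asm_step c c' : 0 < M -> sound c -> step c c' -> asm_reach T tau (asm c) (asm c').
Proof.
move=> M0 S st; have S' := step_invariant M0 mE S st.
pose mix (L : list pos) : assembly := fun b => if `[< In b L >] then asm c' b else asm c b.
have le_mix L p t : asm c p = Some t -> mix L p = Some t.
  by move=> E; rewrite /mix; case: asboolP => // _; apply: asm_step_mono st E.
have R L : asm_reach T tau (asm c) (mix L).
  elim: L => [|b L IH].
    suff -> : mix nil = asm c by apply: Relation_Operators.rt_refl.
    by apply: funext => p; rewrite /mix; case: asboolP.
  case: (pselect (mix L b = asm c' b)) => [E|ne].
    suff -> : mix (b :: L) = mix L by [].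
    apply: funext => p; rewrite /mix; case: asboolP => /= [[<-|h]|h].
    - by move: E; rewrite /mix => ->.
    - by case: asboolP.
    - by case: asboolP => // h'; case: h; right.
  apply: Relation_Operators.rt_trans IH _; apply: Relation_Operators.rt_step.
  have Emix : mix L b = asm c b by move: ne; rewrite /mix; case: asboolP.
  rewrite Emix in ne.
  have Ec : asm c b = None.
    by case E: (asm c b) => [t|] //; case: ne; rewrite E (asm_step_mono M0 S st E).
  case Ec' : (asm c' b) ne => [t|]; last by rewrite Ec.
  move=> _; have [i [hi A Et]] := asm_inv Ec'.
  exists b, t; split; [exact: tile_at_in Et|split; [by rewrite Emix|split]].
    have [e Ee] := entry_at_lt hi.
    move: Et; rewrite /tile_at Ee => -[<-].
    case: (attached_step M0 mE S st hi A) => [/(asm_none M0 S Ec hi)//|sat].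
    by apply: (leq_trans (satisfied_strength M0 S Ee sat)); apply: str_at_mono => p t' /le_mix.
  apply: funext => p; rewrite /mix /upd; case: pos_eqbP => [->|np].
    by rewrite -Ec'; case: asboolP => // -[]; left.
  case: asboolP => /= [[/esym//|h]|h]; case: asboolP => // h'.
  by case: h; right.
(* Outside [L] the assembly [asm c'] is empty, hence so is [asm c]. *)
have [L HL] := asm_finite M0 S'.
suff <- : mix L = asm c' by [].
apply: funext => p; rewrite /mix; case: asboolP => // h.
case E' : (asm c' p) => [t|]; first by case: h; apply: HL; rewrite E'.
by case E: (asm c p) => [t|] //; rewrite (asm_step_mono M0 S st E) in E'.
Qed.

(* No scan has begun in an empty block, so that any entry can still be chosen there. *)
Record represents (c : config cell) (a : assembly) : Prop := Represents {
  rep_sound : sound c;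
  rep_based : based M m free_dir compat_dir c;
  rep_asm : asm c = a;
  rep_scan : forall b s k, a b = None -> 0 <= k < m ->
    Scan s \notin c (m * b.1 + k, m * b.2) }.

(** * Following tile attachments by runs *)

(** The block is unscanned, so a suitable entry can be chosen there. New scans lie on the bottom row
    of this block alone, so the other empty blocks stay unscanned. *)
Lemma represents_attach c a a' : 0 < M -> represents c a -> attach T tau a a' ->
  exists2 c', reach c c' & represents c' a'.
Proof.
move=> M0 [S B <- N] [b [t [tT [Eb [str ->]]]]]; have leM := le_Mm M0 mE.
have [i [hi Et sat]] := strength_satisfied M0 S tT str.
have [c1 [r1 C1 S1 A1]] : exists c', [/\ reach c c', chosen m c' b i,
    forall p s, Scan s \in c' p ->
      Scan s \in c p \/ exists2 k, 0 <= k < m & p = (m * b.1 + k, m * b.2) &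
    forall b' i, 0 <= i < M -> attached M m c' b' i -> attached M m c b' i].
  apply: (choose_reach M0 mE S B); first by lia.
  by move=> s k; apply: N.
have sub1 p := reach_sub p r1.
have sd1 := reach_invariant M0 mE S r1.
have B1 := based_sub sub1 B.
have sat1 d : satisfied M m free_dir compat_dir c1 b i d.
  case: (sat d) => [|[j [hj R A]]]; [by left|right; exists j; split=> //].
  exact: (subsetP (sub1 _)).
have [c2 [r2 A2 U2 S2]] := attach_reach M0 mE sd1 B1 hi C1 sat1.
have sub2 p := reach_sub p r2.
have sd2 := reach_invariant M0 mE sd1 r2.
exists c2; first exact: reach_trans r1 r2.
split=> //; first exact: based_sub sub2 B1.
- apply: funext => p; rewrite /upd; case: pos_eqbP => [->|np].
    exact: (asm_attached M0 sd2 hi A2 Et).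
  case E: (asm c p) => [t'|].
    have [j [hj A Et']] := asm_inv E.
    apply: (asm_attached M0 sd2 hj _ Et').
    by apply: (subsetP (sub2 _)); apply: (subsetP (sub1 _)).
  case E2: (asm c2 p) => [t'|] //; have [j [hj A Et']] := asm_inv E2.
  case: (U2 _ _ hj A) => [/(A1 _ _ hj)|[? _] //].
  by move/(asm_none M0 S E hj).
- move=> b' s k; rewrite /upd; case: pos_eqbP => // np E hk.
  apply/negP => /S2 /S1 [|[k' hk' [E1 E2]]]; first by apply/negP; apply: N.
  have [e1 _] := block_inj hk hk' E1.
  have [e2 _] : b'.2 = b.2 /\ 0 = 0 by apply: (@block_inj m); lia.
  by apply: np; apply: pos_ext.
Qed.

Lemma represents_reach c a a' : 0 < M -> represents c a -> asm_reach T tau a a' ->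
  exists2 c', reach c c' & represents c' a'.
Proof.
move=> M0 R H; elim: H c R => [x y st c R|x c R|x y z _ IH1 _ IH2 c R].
- exact: represents_attach M0 R st.
- by exists c => //; apply: reach_refl.
- have [c1 r1 R1] := IH1 _ R; have [c2 r2 R2] := IH2 _ R1.
  by exists c2 => //; apply: reach_trans r1 r2.
Qed.

(** * The initial configuration *)

Lemma list_bound (D : list pos) :
  exists n, forall p, In p D -> Z.abs p.1 <= n /\ Z.abs p.2 <= n.
Proof.
elim: D => [|q D [n IH]]; first by exists 0.
exists (Z.max n (Z.max (Z.abs q.1) (Z.abs q.2))) => p /= [<-|/IH]; lia.
Qed.

Lemma box_finite n : exists D : list pos,
  forall x y, Z.abs x <= n -> Z.abs y <= n -> In (x, y) D.
Proof.
pose r := List.map (fun k => Z.of_nat k - n) (List.seq 0 (Z.to_nat (2 * n + 1))).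
have R z : Z.abs z <= n -> In z r.
  move=> hz; apply/in_map_iff; exists (Z.to_nat (z + n)); split; first by lia.
  by apply/in_seq; lia.
by exists (list_prod r r) => x y /R hx /R hy; apply/in_prod.
Qed.

(** Seed tiles are attached outright, without [Met] facts; the scan leading to each is included
    because the invariant wants attached entries to be chosen. *)
Definition seeded (sigma : assembly) (index : tile -> Z) (p : pos) (f : fact) : Prop :=
  match f with
  | Static l k => [/\ - m <= p.1 <= m, - m <= p.2 <= m &
                      table M m free_dir compat_dir k (coord l p.1 p.2)]
  | Scan s => exists b t k, [/\ sigma b = Some t, p = (m * b.1 + k, m * b.2), 0 <= k < m &
                                if s then k = index t else k < index t]
  | Dyn Col Attached => exists b t, sigma b = Some t /\ p = home M m b (index t)
  | _ => False
  end.

Lemma represents_seed sigma : 0 < M -> finite_asm sigma ->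
  (forall b t, sigma b = Some t -> In t T) -> exists c, represents c sigma.
Proof.
move=> M0 [Ds HDs] sT; have leM := le_Mm M0 mE; have mgt := m_gt0 M0 mE.
have /choice [index Hix] : forall t, exists i, In t T ->
    0 <= i < M /\ tile_at i = Some t.
  move=> t; case: (pselect (In t T)) => [tT|nT]; last by exists 0.
  (* Any entry with tile [t] serves, since seed attachments undergo no check; zero claims are always
     listed. *)
  have [i hi E] : exists2 i, 0 <= i < M & entry_at i = Some (t, (0%N, 0%N, 0%N, 0%N)).
    by apply: entry_in; do ?[apply/in_prod => //]; apply/in_seq; lia.
  by exists i => _; split=> //; rewrite /tile_at E.
have ix b t : sigma b = Some t -> 0 <= index t < M.
  by move/sT/Hix; case.
pose c : config cell := fun p => [set f | `[< seeded sigma index p f >]].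
have cP p f : f \in c p <-> seeded sigma index p f.
  by rewrite inE; split=> [/asboolP|?]; last exact/asboolP.
have att b i : 0 <= i < M -> attached M m c b i ->
    exists2 t, sigma b = Some t & i = index t.
  move=> hi /cP /= [b' [t [Es [E1 E2]]]]; exists t; last first.
    by have [] := block_injM M0 mE hi (ix _ _ Es) E1.
  suff -> : b = b' by [].
  have [e1 ?] := block_injM M0 mE hi (ix _ _ Es) E1.
  have [e2 ?] := block_injMM M0 mE hi (ix _ _ Es) E2.
  exact: pos_ext.
have sd : sound c.
  split.
  - move=> x y [l k|s|[] [| |d|d]] /cP //=.
    + by case.
    + move=> [b [t [k [Es [-> ->] hk hs]]]]; exists b, k; split=> // i' hi'.
      apply/cP; exists b, t, i'; split=> //; first by lia.
      by case: s hs => hs; lia.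
    + move=> [b [t [Es [-> ->]]]]; have hi := ix _ _ Es.
      exists b, (index t), (M * index t); split=> //; first exact: (row_bound M0 mE).
      split; first by apply/cP; exists b, t.
      by apply/cP; exists b, t, (index t); split=> //; lia.
  - move=> p /cP [b [t [k [Es -> hk Ek]]]]; apply/negP => /cP [b' [t' [k' [Es' [E1 E2] hk' lt]]]].
    have [e1 ek] := block_inj hk hk' E1.
    have [e2 _] : b.2 = b'.2 /\ 0 = 0 by apply: (@block_inj m); lia.
    have Eb : b = b' by exact: pos_ext.
    by subst b'; rewrite Es in Es'; case: Es' => ?; subst; lia.
  (* This box contains both the square of static facts and all blocks with coordinates at most n in
     absolute value. *)
  - have [n Hn] := list_bound Ds; have [D HD] := box_finite (m * (Z.abs n + 1)).
    exists D => -[x y] ne.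
    have nb b t : sigma b = Some t -> Z.abs b.1 <= n /\ Z.abs b.2 <= n.
      by move=> E; apply/Hn/HDs; rewrite E.
    have [f /cP Hf] : exists f, f \in c (x, y).
      by apply/set0Pn/eqP.
    case: f Hf => [l k|s|[] [| |d|d]] //=.
    + by move=> [hx hy _]; apply: HD; nia.
    + by move=> [b [t [k [Es [-> ->] hk _]]]]; have := nb _ _ Es => ?; apply: HD; nia.
    + move=> [b [t [Es [-> ->]]]]; have := nb _ _ Es => ?; have hi := ix _ _ Es.
      by have := row_bound M0 mE hi => ?; apply: HD; nia.
exists c; split=> //.
- by move=> l k x y hx hy H; apply/cP.
- apply: funext => b; case E: (sigma b) => [t|].
    apply: (asm_attached M0 sd (ix _ _ E)); first by apply/cP; exists b, t.
    by case: (Hix t (sT _ _ E)).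
  case E': (asm c b) => [t|] //; have [i [hi A _]] := asm_inv E'.
  by have [t' Es _] := att _ _ hi A; rewrite E in Es.
- move=> b s k E hk; apply/negP => /cP [b' [t' [k' [Es' [E1 E2] hk' _]]]].
  have [e1 ek] := block_inj hk hk' E1.
  have [e2 _] : b.2 = b'.2 /\ 0 = 0 by apply: (@block_inj m); lia.
  have Eb : b = b' by exact: pos_ext.
  by subst b'; rewrite E in Es'.
Qed.

Lemma asm_reach_iter c c' n : 0 < M -> sound c -> iter_rel step n c c' ->
  sound c' /\ asm_reach T tau (asm c) (asm c').
Proof.
move=> M0 S; elim: n c' => [c' ->|n IH c' [z [/IH [Sz R] st]]].
  by split=> //; apply: Relation_Operators.rt_refl.
split; first exact: (step_invariant M0 mE Sz st).
exact: Relation_Operators.rt_trans R (asm_step M0 Sz st).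
Qed.
End Tiles.

(** * Runs of the packed automaton *)

Section Packing.
Variables (S : finType) (kN : nat) (N : kN.-tuple pos) (delta : kN.-tuple S -> {set S}).
Variables (m1 m2 : nat).
Hypotheses (m1_gt0 : 0 < m1) (m2_gt0 : 0 < m2).

Let resc := @glob_resc S kN N delta m1 m2 1 (0%Z, 0%Z).

Lemma packc_inj (c c' : config S) : packc c = packc c' :> config (block S m1 m2) -> c = c'.
Proof.
move=> E; apply: funext => -[x y].
have hx := Z.mod_pos_bound x (Z.of_nat m1); have hy := Z.mod_pos_bound y (Z.of_nat m2).
have lx : (Z.to_nat (x mod Z.of_nat m1) < m1)%N by lia.
have ly : (Z.to_nat (y mod Z.of_nat m2) < m2)%N by lia.
move: (congr1 (fun C => C (x / Z.of_nat m1, y / Z.of_nat m2)%Z (Ordinal lx) (Ordinal ly)) E).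
rewrite /packc /= !Z2Nat.id ?(proj1 (hx _)) ?(proj1 (hy _)); try lia.
by rewrite -!Z.div_mod; try lia.
Qed.

Lemma glob_rescP C C' : resc C C' <->
  exists c c', [/\ C = packc c, glob N delta c c' & C' = packc c'].
Proof.
have sh (c : config S) : shiftc (0%Z, 0%Z) c = c.
  by apply: funext => -[x y]; rewrite /shiftc /subp /= !Z.sub_0_r.
split=> [[c [c' [-> [[z [-> st]] ->]]]]|[c [c' [-> st ->]]]].
  by exists c, c'; rewrite sh.
by exists c, c'; rewrite sh; split=> //; split=> //; exists c.
Qed.

(** Packing is injective, so the configuration unpacked at each step is the one packed before. *)
Lemma iter_pack n c C : iter_rel resc n (packc c) C <->
  exists2 c', C = packc c' & iter_rel (glob N delta) n c c'.
Proof.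
elim: n C => [|n IH] C /=.
  by split=> [->|[c' -> -> //]]; exists c.
split=> [[Z [/IH [z -> it] /glob_rescP [z1 [c' [/packc_inj <- st ->]]]]]|].
  by exists c' => //; exists z.
move=> [c' -> [z [it st]]]; exists (packc z); split; first by apply/IH; exists z.
by apply/glob_rescP; exists z, c'.
Qed.
End Packing.

(** * Verification of the simulation conditions *)

Theorem theorem1 :
  exists (S : finType) (q : S) (kN : nat) (N : kN.-tuple pos)
         (delta : kN.-tuple S -> {set S}),
    List.NoDup (tval N) /\
    delta [tuple of nseq kN q] = [set q] /\
    forall (T : list tile) (sigma : assembly) (tau : nat),
      is_TAS T sigma tau ->
      exists c0 : config S,
        finite_config q c0 /\ simulates N delta c0 T sigma tau.
Proof.
exists cell, set0, 7, nbhd, local_rule; split.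
  by rewrite /=; repeat constructor; rewrite /=; intuition congruence.
split; first exact: local_rule_quiescent.
move=> T sigma tau [sT [[p0 sp0] [fin _]]].
(* A seed tile with zero claims is an entry, so blocks have positive side. *)
have w0 : 0 < width T tau.
  case E0: (sigma p0) sp0 => [t|] // _; have tT := sT _ _ E0.
  have : In (t, (0, 0, 0, 0)) (entries T tau).
    by do ?[apply/in_prod => //]; apply/in_seq; lia.
  by rewrite /width; case: (entries T tau).
have M0 : (0 < Z.of_nat (width T tau))%Z by lia.
have mm0 : 0 < width T tau * width T tau by rewrite muln_gt0 w0.
have [c0 R0] := represents_seed M0 fin sT.
exists c0; split; first exact: inv_finite (rep_sound R0).
exists (width T tau * width T tau), (width T tau * width T tau), 1, (0%Z, 0%Z), (@read T tau).
have A0 := rep_asm R0.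
split=> //; split=> //; split; [|split].
- move=> C [n /(iter_pack _ _ mm0 mm0) [c -> it]].
  have [_ H] := asm_reach_iter M0 (rep_sound R0) it.
  by rewrite A0 in H.
- move=> C al be n [k /(iter_pack _ _ mm0 mm0) [c -> it]] _ _ <- [C' [H <-]].
  have [Sc _] := asm_reach_iter M0 (rep_sound R0) it.
  move/(iter_pack _ _ mm0 mm0): H => [c' -> it'].
  by have [_] := asm_reach_iter M0 Sc it'.
(* A single configuration serves all later assemblies [be], because its empty blocks are still
   unscanned. *)
- move=> al pal; have [c [n it] R] := represents_reach M0 R0 pal.
  exists (packc c); split; first by exists n; apply/(iter_pack _ _ mm0 mm0); exists c.
  split; first exact: rep_asm R.
  move=> be _ ab; have [c' [k it'] R'] := represents_reach M0 R ab.
  exists k, (packc c'); split; first by apply/(iter_pack _ _ mm0 mm0); exists c'.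
  exact: rep_asm R'.
Qed.
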